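(* Let $K$ be a field of characteristic different from $2$ and let $X$ be a connected poset such that every multiplicative automorphism of $FI(X,K)$ is inner and every derivation from $FI(X,K)$ to $I(X,K)$ is inner. Let $\lambda$ be an involution on $X$ with exactly one fixed point in $X$. Each involution on $D(X,K)$ that induces $\lambda$ on $X$ is equivalent to either $\widetilde{\rho_\lambda}$ or $\widetilde{\rho_\lambda}\circ\widetilde{-\delta}$.
   Context: For a field $K$ and a poset $X$, the incidence space $I(X,K)$ is the $K$-space of functions $f:X\times X\to K$ with $f(x,y)=0$ whenever $x\nleq y$. The finitary incidence algebra $FI(X,K)$ is the subspace of all $f\in I(X,K)$ such that for all $x\le y$ in $X$ there are only finitely many subintervals $[u,v]\subseteq[x,y]$ with $u\ne v$ and $f(u,v)\neq 0$. It is an associative unital $K$-algebra, with unity $\delta$, under convolution $(fg)(x,y)=\sum_{x\le z\le y}f(x,z)g(z,y)$, and the same formula makes $I(X,K)$ an $FI(X,K)$-bimodule. $D(X,K)$ is the $K$-algebra $FI(X,K)\oplus I(X,K)$, elements written as columns, with multiplication $\begin{bmatrix}f\\ i\end{bmatrix}\begin{bmatrix}g\\ j\end{bmatrix}=\begin{bmatrix}fg\\ fj+ig\end{bmatrix}$. An automorphism of an algebra is inner if it has the form $a\mapsto uau^{-1}$, $u$ a unit. An involution on a $K$-algebra is a $K$-linear anti-automorphism whose square is the identity; an involution on a poset $X$ is a bijection $\lambda$ with $x\le y\Leftrightarrow\lambda(y)\le\lambda(x)$ and $\lambda^2=\mathrm{id}$. Involutions $\phi,\varphi$ on a $K$-algebra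 $A$ are equivalent if $\Psi\circ\phi=\varphi\circ\Psi$ for some $K$-linear automorphism $\Psi$ of $A$. A poset is connected if any two elements are joined by a finite sequence in which consecutive elements are comparable. A multiplicative automorphism of $FI(X,K)$ is a map $M_\sigma(f)(x,y)=\sigma(x,y)f(x,y)$, where $\sigma\in I(X,K)$ satisfies $\sigma(x,y)\neq0$ for all $x\le y$ and $\sigma(x,y)\sigma(y,z)=\sigma(x,z)$ for $x\le y\le z$. A derivation $D:FI(X,K)\to I(X,K)$ is a $K$-linear map with $D(fg)=D(f)g+fD(g)$; it is inner if there is $i\in I(X,K)$ with $D(f)=fi-if$ for all $f$. Let $e_x\in FI(X,K)$ be $1$ at $(x,x)$ and $0$ elsewhere. An involution $\Phi$ on $D(X,K)$ induces the involution $\lambda$ on $X$ such that $\Phi\left(\begin{bmatrix}e_x\\0\end{bmatrix}\right)$ is conjugate to $\begin{bmatrix}e_{\lambda(x)}\\0\end{bmatrix}$ for every $x\in X$. Set $\rho_\lambda(f)(x,y)=f(\lambda(y),\lambda(x))$ for $f\in FI(X,K)$, let $\overline{\rho_\lambda}$ be given by the same formula on $I(X,K)$, and $\widetilde{\rho_\lambda}\left(\begin{bmatrix}f\\ i\end{bmatrix}\right)=\begin{bmatrix}\rho_\lambda(f)\\ \overline{\rho_\lambda}(i)\end{bmatrix}$. Also $\widetilde{-\delta}\left(\begin{bmatrix}f\\ i\end{bmatrix}\right)=\begin{bmatrix}f\\ -i\end{bmatrix}$. *)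

(* Defs.v *)
From HB Require Import structures.
From mathcomp Require Import all_boot all_order all_algebra.
From mathcomp Require Import all_classical.

Set Implicit Arguments.
Unset Strict Implicit.
Unset Printing Implicit Defensive.

Import Order.TTheory GRing.Theory.

Local Open Scope classical_set_scope.
Local Open Scope ring_scope.

(* Arbitrary posets are modelled by [porderType]: in the classical setting of
   [boolp], every type is a [choiceType] and every relation is decidable. *)

Definition connected_poset (d : Order.disp_t) (X : porderType d) :=
  forall x y : X, exists2 p : seq X, path >=<%O x p & last x p = y.

(* Bijectivity follows from [poset_invK]. *)
Record poset_involution (d : Order.disp_t) (X : porderType d) := PosetInvolution {
  poset_inv :> X -> X;
  poset_inv_le : forall x y : X, (x <= y)%O = (poset_inv y <= poset_inv x)%O;
  poset_invK : involutive poset_inv }.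

Section IncidenceSpace.
Variables (d : Order.disp_t) (X : porderType d) (K : fieldType).

(* [K^o] makes [K], hence the function space, a left [K]-module. *)
Definition incidence_pred : {pred X -> X -> K^o} :=
  fun f => `[< forall x y : X, ~~ (x <= y)%O -> f x y = 0 >].

Record incidence := Incidence {
  inc_val :> X -> X -> K^o;
  _ : inc_val \in incidence_pred }.

HB.instance Definition _ := [isSub for inc_val].
HB.instance Definition _ := [Choice of incidence by <:].

Fact incidence_submod_closed : submod_closed incidence_pred.
Proof.
split; first by apply/asboolP.
move=> a f g /asboolP f0 /asboolP g0; apply/asboolP => x y xy.
rewrite [LHS](_ : _ = a *: f x y + g x y) //.
by rewrite f0 // g0 // scaler0 addr0.
Qed.

HB.instance Definition _ :=
  GRing.isSubmodClosed.Build K (X -> X -> K^o) incidence_pred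
    incidence_submod_closed.
HB.instance Definition _ := [SubChoice_isSubLmodule of incidence by <:].

Lemma inc0 (f : incidence) x y : ~~ (x <= y)%O -> f x y = 0.
Proof. by case: f => f /= /asboolP; apply. Qed.

Lemma inc_le (f : incidence) x y : f x y != 0 -> (x <= y)%O.
Proof. by apply: contraR => /(inc0 f) ->. Qed.

Lemma incP (f g : incidence) : (forall x y, f x y = g x y) -> f = g.
Proof. by move=> fg; apply: val_inj; do 2!apply/funext => ?; apply: fg. Qed.

(* Nonempty intervals [[u, v]] are encoded by their endpoints. *)
Definition finitary_pred : {pred incidence} :=
  fun f => `[< forall x y : X, (x <= y)%O ->
    finite_set [set p : X * X | [/\ (x <= p.1)%O, (p.1 <= p.2)%O,
      (p.2 <= y)%O, p.1 != p.2 & f p.1 p.2 != 0]] >].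

Record finc := Finc {
  finc_val :> incidence;
  _ : finc_val \in finitary_pred }.

HB.instance Definition _ := [isSub for finc_val].
HB.instance Definition _ := [Choice of finc by <:].

Fact finc_submod_closed : submod_closed finitary_pred.
Proof.
split.
  apply/asboolP => x y _; apply: (sub_finite_set _ (finite_set0 _)) => -[u v] [].
  by move=> _ _ _ _ /=; rewrite [X in X != _](_ : _ = 0) // eqxx.
move=> a f g /asboolP hf /asboolP hg; apply/asboolP => x y xy.
have := conj (hf _ _ xy) (hg _ _ xy); rewrite -finite_setU.
apply: sub_finite_set.
move=> -[u v] [/= xu uv vy nuv].
rewrite [X in X != _](_ : _ = a *: f u v + g u v) // => h.
have [f0|] := eqVneq (f u v) 0; last by left.
by right; split => //; move: h; rewrite f0 scaler0 add0r.
Qed.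

HB.instance Definition _ :=
  GRing.isSubmodClosed.Build K incidence finitary_pred finc_submod_closed.
HB.instance Definition _ := [SubChoice_isSubLmodule of finc by <:].

Lemma fincP (f g : finc) : (forall x y, f x y = g x y) -> f = g.
Proof. by move=> fg; apply: val_inj; apply: incP. Qed.

Lemma incDE (f g : incidence) x y : (f + g) x y = f x y + g x y.
Proof. by []. Qed.
Lemma incNE (f : incidence) x y : (- f) x y = - f x y.
Proof. by []. Qed.
Lemma incZE a (f : incidence) x y : (a *: f) x y = a * f x y.
Proof. by []. Qed.
Lemma fincDE (f g : finc) x y : (f + g) x y = f x y + g x y.
Proof. by []. Qed.
Lemma fincZE a (f : finc) x y : (a *: f) x y = a * f x y.
Proof. by []. Qed.

(* A finite set containing the endpoints [x], [y] and those of all the proper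
   subintervals of [[x, y]] on which [f] does not vanish. *)
Lemma finc_support (f : finc) x y : exists2 T : seq X, x \in T /\ y \in T &
  forall u v, (x <= u)%O -> (v <= y)%O -> u != v -> f u v != 0 ->
  u \in T /\ v \in T.
Proof.
have [xy|nxy] := boolP (x <= y)%O; last first.
  exists [:: x; y]; first by rewrite !inE !eqxx orbT.
  move=> u v xu vy _ /inc_le uv; case/negP: nxy.
  exact: le_trans xu (le_trans uv vy).
case: f => -[f fI] /= fF; have /asboolP/(_ _ _ xy)/finite_seqP[s sE] := fF.
exists [:: x, y & map fst s ++ map snd s]; first by rewrite !inE !eqxx orbT.
move=> u v xu vy nuv fuv; rewrite !inE !mem_cat.
have uv : (u <= v)%O by exact: (@inc_le (Incidence fI)).
have : (u, v) \in s.
  by suff: [set` s] (u, v) by []; rewrite -sE.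
move=> h; have hu := map_f fst h; have hv := map_f snd h.
by rewrite hu hv !orbT.
Qed.

Definition conv (f g : incidence) (x y : X) : K^o :=
  \sum_(z \in [set z | (x <= z <= y)%O]) f x z * g z y.

Lemma convE (f g : incidence) x y (T : seq X) : uniq T ->
  (forall z, f x z != 0 -> g z y != 0 -> z \in T) ->
  conv f g x y = \sum_(z <- T) f x z * g z y.
Proof.
move=> uT hT; rewrite fsbig_seq // /conv.
have fg0 z : f x z * g z y != 0 -> f x z != 0 /\ g z y != 0.
  by rewrite mulf_eq0 negb_or => /andP.
rewrite [LHS]fsbig_supp [RHS]fsbig_supp.
apply: eq_fsbigl; apply/seteqP; split => z /= [_ /eqP fg]; split; try exact/eqP.
  by have [fz gz] := fg0 z fg; apply: hT.
by have [/inc_le-> /inc_le->] := fg0 z fg.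
Qed.

Lemma conv_neq0 (f g : incidence) x y : conv f g x y != 0 ->
  exists z, f x z != 0 /\ g z y != 0.
Proof.
apply: contraPP => /forallNP h; apply/negP; rewrite negbK; apply/eqP.
apply: fsbig1 => z _; apply: contra_notP (h z) => /eqP.
by rewrite mulf_eq0 negb_or => /andP[].
Qed.

Fact conv_incidence (f g : incidence) : (conv f g : X -> X -> K^o) \in incidence_pred.
Proof.
apply/asboolP => x y; apply: contraNeq => /conv_neq0[z [/inc_le xz /inc_le zy]].
exact: le_trans xz zy.
Qed.

(* The convolution [f * g] of incidence functions is only meaningful when one
   of them is finitary, as it is in all the uses below. *)
Definition inc_mul (f g : incidence) : incidence := Incidence (conv_incidence f g).

Fact inc_mul_finitary (f g : finc) : inc_mul f g \in finitary_pred.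
Proof.
apply/asboolP => x y xy.
have [T [xT yT] hf] := finc_support f x y.
have [U [xU yU] hg] := finc_support g x y.
apply: (@sub_finite_set _ _ [set` [seq (u, v) | u <- T ++ U, v <- T ++ U]]);
  last exact: finite_seq.
move=> -[u v] [/= xu uv vy nuv] /conv_neq0[z [fuz gzv]].
have uz := inc_le fuz; have zv := inc_le gzv.
suff [hu hv] : u \in T ++ U /\ v \in T ++ U by apply: allpairs_f.
rewrite !mem_cat; have [uz0|nuz] := eqVneq u z.
  rewrite -uz0 in gzv; have [-> ->] := hg _ _ xu vy nuv gzv.
  by rewrite !orbT.
have [-> zT] := hf _ _ xu (le_trans zv vy) nuz fuz.
have [<-|nzv] := eqVneq z v; first by rewrite zT.
by have [_ ->] := hg _ _ (le_trans xu uz) vy nzv gzv; rewrite orbT.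
Qed.

Definition finc_mul (f g : finc) : finc := Finc (inc_mul_finitary f g).

Fact delta_incidence : ((fun x y => (x == y)%:R) : X -> X -> K^o) \in incidence_pred.
Proof. by apply/asboolP => x y; case: eqVneq => // ->; rewrite lexx. Qed.

Fact delta_finitary : Incidence delta_incidence \in finitary_pred.
Proof.
apply/asboolP => x y _; apply: (sub_finite_set _ (finite_set0 _)) => -[u v] [/=].
by move=> _ _ _ /negbTE ->; rewrite eqxx.
Qed.

Definition delta : finc := Finc delta_finitary.

Fact idem_incidence (x : X) :
  ((fun u v => ((u == x) && (v == x))%:R) : X -> X -> K^o) \in incidence_pred.
Proof.
apply/asboolP => u v; case: (eqVneq u x) => // ->.
by case: (eqVneq v x) => // ->; rewrite lexx.
Qed.

Fact idem_finitary x : Incidence (idem_incidence x) \in finitary_pred.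
Proof.
apply/asboolP => y z _; apply: (sub_finite_set _ (finite_set0 _)) => -[u v] [/=].
move=> _ _ _ nuv; case: (eqVneq u) => [ux|]; last by rewrite eqxx.
by case: (eqVneq v) => [vx|]; [rewrite ux vx eqxx in nuv | rewrite eqxx].
Qed.

Definition idem x : finc := Finc (idem_finitary x).

(* All the sums defining [inc_mul f g] are finite. *)
Definition small (f g : incidence) := forall x y, exists2 T : seq X, uniq T &
  forall z, f x z != 0 -> g z y != 0 -> z \in T.

Lemma small_fincl (f : finc) g : small f g.
Proof.
move=> x y; have [T [xT yT] hf] := finc_support f x y.
exists (undup T); first exact: undup_uniq.
move=> z fxz /inc_le zy; rewrite mem_undup; have [<- //|xz] := eqVneq x z.
by have [] := hf _ _ (lexx _) zy xz fxz.
Qed.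

Lemma small_fincr f (g : finc) : small f g.
Proof.
move=> x y; have [T [xT yT] hg] := finc_support g x y.
exists (undup T); first exact: undup_uniq.
move=> z /inc_le xz gzy; rewrite mem_undup; have [-> //|zy] := eqVneq z y.
by have [] := hg _ _ xz (lexx _) zy gzy.
Qed.

Lemma inc_mul_lin_l a (f g h : incidence) : small f h -> small g h ->
  inc_mul (a *: f + g) h = a *: inc_mul f h + inc_mul g h.
Proof.
move=> sf sg; apply: incP => x y; rewrite incDE incZE /=.
have [T _ hT] := sf x y; have [U _ hU] := sg x y.
have uV : uniq (undup (T ++ U)) by exact: undup_uniq.
have -> : conv (a *: f + g) h x y = \sum_(z <- undup (T ++ U)) (a *: f + g) x z * h z y.
  apply: convE => // z; rewrite incDE incZE mem_undup mem_cat => hz hz'.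
  have [f0|fn0] := eqVneq (f x z) 0; last by rewrite hT.
  by rewrite hU ?orbT //; move: hz; rewrite f0 mulr0 add0r.
have -> : conv f h x y = \sum_(z <- undup (T ++ U)) f x z * h z y.
  by apply: convE => // z hz hz'; rewrite mem_undup mem_cat hT.
have -> : conv g h x y = \sum_(z <- undup (T ++ U)) g x z * h z y.
  by apply: convE => // z hz hz'; rewrite mem_undup mem_cat hU ?orbT.
rewrite mulr_sumr -big_split; apply: eq_bigr => z _.
by rewrite incDE incZE mulrDl mulrA.
Qed.

Lemma inc_mul_lin_r a (f g h : incidence) : small h f -> small h g ->
  inc_mul h (a *: f + g) = a *: inc_mul h f + inc_mul h g.
Proof.
move=> sf sg; apply: incP => x y; rewrite incDE incZE /=.
have [T _ hT] := sf x y; have [U _ hU] := sg x y.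
have uV : uniq (undup (T ++ U)) by exact: undup_uniq.
have -> : conv h (a *: f + g) x y = \sum_(z <- undup (T ++ U)) h x z * (a *: f + g) z y.
  apply: convE => // z; rewrite incDE incZE mem_undup mem_cat => hz hz'.
  have [f0|fn0] := eqVneq (f z y) 0; last by rewrite hT.
  by rewrite hU ?orbT //; move: hz'; rewrite f0 mulr0 add0r.
have -> : conv h f x y = \sum_(z <- undup (T ++ U)) h x z * f z y.
  by apply: convE => // z hz hz'; rewrite mem_undup mem_cat hT.
have -> : conv h g x y = \sum_(z <- undup (T ++ U)) h x z * g z y.
  by apply: convE => // z hz hz'; rewrite mem_undup mem_cat hU ?orbT.
rewrite mulr_sumr -big_split; apply: eq_bigr => z _.
by rewrite incDE incZE mulrDr mulrCA.
Qed.

Definition small3 (f g h : incidence) := forall x y, exists2 T : seq X, uniq T &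
  forall z w, f x z != 0 -> g z w != 0 -> h w y != 0 -> z \in T /\ w \in T.

Lemma inc_mulA_small f g h : small3 f g h ->
  inc_mul f (inc_mul g h) = inc_mul (inc_mul f g) h.
Proof.
move=> s3; apply: incP => x y /=; have [T uT hT] := s3 x y.
have -> : conv f (inc_mul g h) x y = \sum_(z <- T) f x z * conv g h z y.
  apply: convE => // z fz /conv_neq0[w [gzw hw]].
  by have [] := hT z w fz gzw hw.
have -> : conv (inc_mul f g) h x y = \sum_(w <- T) conv f g x w * h w y.
  apply: convE => // w /conv_neq0[z [fz gzw]] hw.
  by have [] := hT z w fz gzw hw.
transitivity (\sum_(z <- T) \sum_(w <- T) f x z * (g z w * h w y)).
  apply: eq_bigr => z _; have [->|fz] := eqVneq (f x z) 0.
    by rewrite mul0r big1 // => w _; rewrite mul0r.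
  rewrite (convE uT) ?mulr_sumr // => w gzw hw.
  by have [] := hT z w fz gzw hw.
rewrite exchange_big; apply: eq_bigr => w _.
have [->|hw] := eqVneq (h w y) 0.
  by rewrite mulr0 big1 // => z _; rewrite !mulr0.
rewrite (convE uT) ?mulr_suml; first by apply: eq_bigr => z _; rewrite mulrA.
by move=> z fz gzw; have [] := hT z w fz gzw hw.
Qed.

Lemma small3_12 (f g : finc) h : small3 f g h.
Proof.
move=> x y; have [T [xT yT] hf] := finc_support f x y.
have [U [xU yU] hg] := finc_support g x y.
exists (undup (T ++ U)); first exact: undup_uniq.
move=> z w fz gzw hw; rewrite !mem_undup !mem_cat.
have [xz zw wy] := And3 (inc_le fz) (inc_le gzw) (inc_le hw).
have zT : z \in T.
  have [<- //|nxz] := eqVneq x z.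
  by have [] := hf _ _ (lexx _) (le_trans zw wy) nxz fz.
rewrite zT; split=> //; have [<-|nzw] := eqVneq z w; first by rewrite zT.
by have [_ ->] := hg _ _ xz wy nzw gzw; rewrite orbT.
Qed.

Lemma small3_23 f (g h : finc) : small3 f g h.
Proof.
move=> x y; have [T [xT yT] hh] := finc_support h x y.
have [U [xU yU] hg] := finc_support g x y.
exists (undup (T ++ U)); first exact: undup_uniq.
move=> z w fz gzw hw; rewrite !mem_undup !mem_cat.
have [xz zw wy] := And3 (inc_le fz) (inc_le gzw) (inc_le hw).
have wT : w \in T.
  have [-> //|nwy] := eqVneq w y.
  by have [] := hh _ _ (le_trans xz zw) (lexx _) nwy hw.
rewrite wT; split=> //; have [->|nzw] := eqVneq z w; first by rewrite wT.
by have [-> _] := hg _ _ xz wy nzw gzw; rewrite orbT.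
Qed.

Lemma small3_13 (f : finc) g (h : finc) : small3 f g h.
Proof.
move=> x y; have [T [xT yT] hf] := finc_support f x y.
have [U [xU yU] hh] := finc_support h x y.
exists (undup (T ++ U)); first exact: undup_uniq.
move=> z w fz gzw hw; rewrite !mem_undup !mem_cat.
have [xz zw wy] := And3 (inc_le fz) (inc_le gzw) (inc_le hw).
split; apply/orP; [left|right].
  have [<- //|nxz] := eqVneq x z.
  by have [] := hf _ _ (lexx _) (le_trans zw wy) nxz fz.
have [-> //|nwy] := eqVneq w y.
by have [] := hh _ _ (le_trans xz zw) (lexx _) nwy hw.
Qed.

Lemma inc_mul1l (i : incidence) : inc_mul delta i = i.
Proof.
apply: incP => x y /=; rewrite (@convE _ _ _ _ [:: x]) //; last first.
  by move=> z /=; rewrite inE (eq_sym z x); case: (eqVneq x z) => //; rewrite eqxx.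
by rewrite big_seq1 /= eqxx mul1r.
Qed.

Lemma inc_mul1r (i : incidence) : inc_mul i delta = i.
Proof.
apply: incP => x y /=; rewrite (@convE _ _ _ _ [:: y]) //; last first.
  by move=> z _ /=; rewrite inE; case: (eqVneq z y) => //; rewrite eqxx.
by rewrite big_seq1 /= eqxx mulr1.
Qed.

Fact finc_mulA : associative finc_mul.
Proof. by move=> f g h; apply: val_inj; apply: inc_mulA_small; apply: small3_12. Qed.

Fact finc_mul1l : left_id delta finc_mul.
Proof. by move=> f; apply: val_inj; apply: inc_mul1l. Qed.

Fact finc_mul1r : right_id delta finc_mul.
Proof. by move=> f; apply: val_inj; apply: inc_mul1r. Qed.

Lemma finc_mul_lin_l a (f g h : finc) :
  finc_mul (a *: f + g) h = a *: finc_mul f h + finc_mul g h.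
Proof. by apply: val_inj; apply: inc_mul_lin_l; apply: small_fincl. Qed.

Lemma finc_mul_lin_r a (f g h : finc) :
  finc_mul h (a *: f + g) = a *: finc_mul h f + finc_mul h g.
Proof. by apply: val_inj; apply: inc_mul_lin_r; apply: small_fincl. Qed.

Fact finc_mulDl : left_distributive finc_mul +%R.
Proof. by move=> f g h; have := finc_mul_lin_l 1 f g h; rewrite !scale1r. Qed.

Fact finc_mulDr : right_distributive finc_mul +%R.
Proof. by move=> h f g; have := finc_mul_lin_r 1 f g h; rewrite !scale1r. Qed.

(* MathComp's [algType] excludes the zero algebra, which occurs for empty [X];
   hence the algebra is given by its [lmodType] and [pzRingType] structures
   and the lemmas [finc_scaleAl] and [finc_scaleAr]. *)
HB.instance Definition _ := GRing.Zmodule_isPzRing.Build finc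
  finc_mulA finc_mul1l finc_mul1r finc_mulDl finc_mulDr.

Lemma finc_scaleAl a (f g : finc) : a *: (f * g) = (a *: f) * g.
Proof.
by rewrite -[a *: f]addr0 [RHS]finc_mul_lin_l [finc_mul 0 g](mul0r g) addr0.
Qed.

Lemma finc_scaleAr a (f g : finc) : a *: (f * g) = f * (a *: g).
Proof.
by rewrite -[a *: g]addr0 [RHS]finc_mul_lin_r [finc_mul f 0](mulr0 f) addr0.
Qed.

(* The [K]-algebra [D(X, K)], with pairs [(f, i)] for columns. *)
Definition dinc : Type := (finc * incidence)%type.

HB.instance Definition _ := GRing.Lmodule.on dinc.

Definition dinc_mul (a b : dinc) : dinc :=
  (a.1 * b.1, inc_mul a.1 b.2 + inc_mul a.2 b.1).

Definition dinc_one : dinc := (delta, 0).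

Lemma dinc_mul_lin_l k (a b c : dinc) :
  dinc_mul (k *: a + b) c = k *: dinc_mul a c + dinc_mul b c.
Proof.
congr pair; first exact: finc_mul_lin_l.
have e1 := inc_mul_lin_l k (small_fincl a.1 c.2) (small_fincl b.1 c.2).
have e2 := inc_mul_lin_l k (small_fincr a.2 c.1) (small_fincr b.2 c.1).
by apply: etrans (congr2 +%R e1 e2) _; rewrite addrACA -scalerDr.
Qed.

Lemma dinc_mul_lin_r k (a b c : dinc) :
  dinc_mul c (k *: a + b) = k *: dinc_mul c a + dinc_mul c b.
Proof.
congr pair; first exact: finc_mul_lin_r.
have e1 := inc_mul_lin_r k (small_fincl c.1 a.2) (small_fincl c.1 b.2).
have e2 := inc_mul_lin_r k (small_fincr c.2 a.1) (small_fincr c.2 b.1).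
by apply: etrans (congr2 +%R e1 e2) _; rewrite addrACA -scalerDr.
Qed.

Lemma inc_mulDl (f g h : incidence) : small f h -> small g h ->
  inc_mul (f + g) h = inc_mul f h + inc_mul g h.
Proof. by move=> sf sg; have := inc_mul_lin_l 1 sf sg; rewrite !scale1r. Qed.

Lemma inc_mulDr (f g h : incidence) : small h f -> small h g ->
  inc_mul h (f + g) = inc_mul h f + inc_mul h g.
Proof. by move=> sf sg; have := inc_mul_lin_r 1 sf sg; rewrite !scale1r. Qed.

Fact dinc_mulA : associative dinc_mul.
Proof.
move=> [f i] [g j] [h k]; congr pair; first exact: mulrA.
rewrite /= inc_mulDr ?inc_mulDl; try exact: small_fincl; try exact: small_fincr.
rewrite addrA; congr (_ + _ + _).
- exact/inc_mulA_small/small3_12.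
- exact/inc_mulA_small/small3_13.
- exact/inc_mulA_small/small3_23.
Qed.

Lemma inc_mul0l (i : incidence) : inc_mul 0 i = 0.
Proof.
by apply: incP => x y; apply: fsbig1 => z _; apply: mul0r.
Qed.

Lemma inc_mul0r (i : incidence) : inc_mul i 0 = 0.
Proof.
by apply: incP => x y; apply: fsbig1 => z _; apply: mulr0.
Qed.

Fact dinc_mul1l : left_id dinc_one dinc_mul.
Proof.
by move=> [f i]; rewrite /dinc_mul /= inc_mul1l inc_mul0l addr0 (mul1r f).
Qed.

Fact dinc_mul1r : right_id dinc_one dinc_mul.
Proof.
by move=> [f i]; rewrite /dinc_mul /= inc_mul1r inc_mul0r add0r (mulr1 f).
Qed.

Fact dinc_mulDl : left_distributive dinc_mul +%R.
Proof. by move=> a b c; have := dinc_mul_lin_l 1 a b c; rewrite !scale1r. Qed.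

Fact dinc_mulDr : right_distributive dinc_mul +%R.
Proof. by move=> c a b; have := dinc_mul_lin_r 1 a b c; rewrite !scale1r. Qed.

HB.instance Definition _ := GRing.Zmodule_isPzRing.Build dinc
  dinc_mulA dinc_mul1l dinc_mul1r dinc_mulDl dinc_mulDr.

Lemma dinc_scaleAl k (a b : dinc) : k *: (a * b) = (k *: a) * b.
Proof.
by rewrite -[k *: a]addr0 [RHS]dinc_mul_lin_l [dinc_mul 0 b](mul0r b) addr0.
Qed.

Lemma dinc_scaleAr k (a b : dinc) : k *: (a * b) = a * (k *: b).
Proof.
by rewrite -[k *: b]addr0 [RHS]dinc_mul_lin_r [dinc_mul a 0](mulr0 a) addr0.
Qed.

Definition multiplicative_inc (sigma : incidence) :=
  (forall x y, (x <= y)%O -> sigma x y != 0) /\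
  (forall x y z, (x <= y)%O -> (y <= z)%O -> sigma x y * sigma y z = sigma x z).

Fact mult_aut_incidence (sigma f : incidence) :
  ((fun x y => sigma x y * f x y) : X -> X -> K^o) \in incidence_pred.
Proof. by apply/asboolP => x y xy; rewrite (inc0 f) // mulr0. Qed.

Fact mult_aut_finitary (sigma : incidence) (f : finc) :
  Incidence (mult_aut_incidence sigma f) \in finitary_pred.
Proof.
apply/asboolP => x y xy; have /asboolP/(_ _ _ xy) := valP f.
apply: sub_finite_set => -[u v] [/= xu uv vy nuv]; rewrite mulf_eq0 negb_or.
by case/andP.
Qed.

Definition mult_aut (sigma : incidence) (f : finc) : finc :=
  Finc (mult_aut_finitary sigma f).

Definition is_derivation (D : finc -> incidence) :=
  linear D /\ forall f g, D (f * g) = inc_mul (D f) g + inc_mul f (D g).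

Definition inner_derivation (D : finc -> incidence) :=
  exists i : incidence, forall f, D f = inc_mul f i - inc_mul i f.

Definition dinc_involution (Phi : dinc -> dinc) :=
  [/\ linear Phi, forall a b, Phi (a * b) = Phi b * Phi a & involutive Phi].

Definition dinc_equivalent (Phi Phi' : dinc -> dinc) :=
  exists Psi : dinc -> dinc,
    [/\ linear Psi, monoid_morphism Psi, bijective Psi & Psi \o Phi =1 Phi' \o Psi].

Definition dinc_neg (a : dinc) : dinc := (a.1, - a.2).

Section Rho.
Variable lambda : poset_involution X.

Fact rho_incidence (f : incidence) :
  ((fun x y => f (lambda y) (lambda x)) : X -> X -> K^o) \in incidence_pred.
Proof. by apply/asboolP => x y; rewrite (poset_inv_le lambda) => /(inc0 f). Qed.

Definition rho_inc (f : incidence) : incidence := Incidence (rho_incidence f).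

Fact rho_finitary (f : finc) : rho_inc f \in finitary_pred.
Proof.
apply/asboolP => x y xy; rewrite (poset_inv_le lambda) in xy.
have /asboolP/(_ _ _ xy) := valP f.
move=> /(finite_image (fun p => (lambda p.2, lambda p.1))).
apply: sub_finite_set => -[u v] [/= xu uv vy nuv fuv].
exists (lambda v, lambda u); last by rewrite /= !poset_invK.
split=> //=; rewrite -?poset_inv_le // eq_sym.
by apply: contra_neq nuv => /(can_inj (poset_invK lambda)).
Qed.

Definition rho (f : finc) : finc := Finc (rho_finitary f).

Definition dinc_rho (a : dinc) : dinc := (rho a.1, rho_inc a.2).

End Rho.

End IncidenceSpace.

Arguments idem {d X} K x.
Arguments dinc_rho {d X} K lambda a.

Definition conjugate (A : pzRingType) (a b : A) :=
  exists u v : A, [/\ u * v = 1, v * u = 1 & b = u * a * v].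

Definition inner_aut (A : pzRingType) (phi : A -> A) :=
  exists u v : A, [/\ u * v = 1, v * u = 1 & forall a, phi a = u * a * v].

Definition induces (d : Order.disp_t) (X : porderType d) (K : fieldType)
    (Phi : dinc X K -> dinc X K) (lambda : poset_involution X) :=
  forall x : X, conjugate (Phi (idem K x, 0) : dinc X K) (idem K (lambda x), 0).

Section RhoTheory.
Variables (d : Order.disp_t) (X : porderType d) (K : fieldType).
Variable lambda : poset_involution X.

Lemma rho_inc_mul (f g : incidence X K) : small f g ->
  rho_inc lambda (inc_mul f g) = inc_mul (rho_inc lambda g) (rho_inc lambda f).
Proof.
move=> s; apply: incP => x y /=; have [T uT hT] := s (lambda y) (lambda x).
rewrite (convE uT hT) (@convE _ _ _ _ _ _ _ [seq lambda z | z <- T]).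
- rewrite big_map; apply: eq_bigr => z _.
  by rewrite /= poset_invK mulrC.
- by rewrite map_inj_uniq //; apply: can_inj (poset_invK lambda).
- move=> z /= gz fz; rewrite -[z](poset_invK lambda); apply: map_f.
  exact: hT.
Qed.

Lemma dinc_rho_involution : dinc_involution (dinc_rho K lambda).
Proof.
split.
- by move=> k [f i] [g j]; congr pair; [apply: fincP|apply: incP].
- move=> [f i] [g j]; congr pair.
    by apply: val_inj; apply: rho_inc_mul; apply: small_fincl.
  rewrite /= addrC [LHS](_ : _ = rho_inc lambda (inc_mul i g) + rho_inc lambda (inc_mul f j));
    last exact: incP.
  by congr (_ + _); apply: rho_inc_mul; [apply: small_fincr|apply: small_fincl].
- move=> [f i]; congr pair; [apply: fincP|apply: incP] => x y /=;
  by rewrite !poset_invK.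
Qed.

Lemma dinc_rho_neg_involution :
  dinc_involution (dinc_rho K lambda \o @dinc_neg d X K).
Proof.
have [L M I] := dinc_rho_involution.
have nL : linear (@dinc_neg d X K).
  move=> k [f i] [g j]; congr pair; rewrite /=.
  by rewrite opprD scalerN.
have nM a b : dinc_neg (a * b) = dinc_neg a * dinc_neg b :> dinc X K.
  case: a b => [f i] [g j]; congr pair; rewrite /= opprD; congr (_ + _).
    by have := inc_mul_lin_r (-1) (small_fincl f j) (small_fincl f 0);
      rewrite inc_mul0r !addr0 !scaleN1r.
  by have := inc_mul_lin_l (-1) (small_fincr i g) (small_fincr 0 g);
    rewrite inc_mul0l !addr0 !scaleN1r.
split.
- by move=> k a b /=; rewrite nL L.
- by move=> a b /=; rewrite nM M.
- move=> a /=; have -> : dinc_neg (dinc_rho K lambda (dinc_neg a)) = dinc_rho K lambda a.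
    case: a => f i; congr pair; apply: incP => x y /=.
    by rewrite [LHS]opprK.
  exact: I.
Qed.

End RhoTheory.

(* Main.v *)
Require Import Defs.
From HB Require Import structures.
From mathcomp Require Import all_boot all_order all_algebra.
From mathcomp Require Import all_classical.

Set Implicit Arguments.
Unset Strict Implicit.
Unset Printing Implicit Defensive.

Import Order.TTheory GRing.Theory.

Local Open Scope ring_scope.

(** Write D = A + I with A = FI(X, K) and I = I(X, K). Composing Phi with the
    standard involution rho of D gives an automorphism Om of the algebra D, and
    the proof first shows that Om is a conjugation composed with the map that
    scales I by a constant c ([dinc_aut_inner]).

    - The centre of D consists of the k + m t, where t is the unity of A seen
      in I ([dinc_central_scalar]); hence Om(t) = c t, which gives Om on the
      finitary part of I. A nonzero finitary function that vanishes on the diagonal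
      has a minimal interval in its support ([minimal_interval]); hence an f in A
      is zero as soon as the compressions of f between the idempotents Om(e_x)
      vanish ([sandwich_eq0]), so that Om preserves I.
    - Let al be the automorphism of A induced by Om. The matrix beta whose b-th column
      is the b-th column of al(e_b) intertwines al(e_b) and e_b. The point is
      that beta is finitary ([col_finitary]): if it were not, a combinatorial
      lemma ([infinite_cut]) would give a set S such that al(e_S) has infinitely many
      nonzero entries in an interval, where e_S is the diagonal idempotent of
      S. Its inverse is the matrix of the rows of the al(e_b), which is
      finitary by the symmetry rho. Conjugation by beta makes al
      multiplicative, hence inner ([endo_inner]).
    - Once al is the identity, Om is f |-> (f, D(f)) on A, with D a derivation,
      and multiplication by c on I; since D is inner, Om is as claimed.

    Hence Phi(a) = v tau(a) q with v the inverse of q and tau = rho composed with the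
    scaling by c; applying Phi twice to t gives c = 1 or c = -1, which are the two cases
    of the theorem. It remains to prove that Phi is equivalent to tau
    ([involution_equivalent]). As Phi is an involution, tau(q) = z q with z
    central. Let x0 be the fixed point. The corner of q at e_x0 is a central
    unit y times e_x0, and comparing corners gives tau(y) = z y: dividing q by y makes it
    tau-symmetric, with corner e_x0 ([scaled_symmetric]). By Zorn's lemma, X is
    the disjoint union of a down-set S, of its image lambda(S), which is an up-set, and
    of x0 ([involution_splitting]). Thus q is block triangular, and since
    2 is invertible it can be written as tau(s) s with s triangular
    ([symmetric_unit_factor]). Conjugation by s is the equivalence sought. *)

(** * Entries of finitary functions *)

Lemma seq_maximal (d : Order.disp_t) (T : porderType d) (s : seq T)
    (P : T -> Prop) (x : T) : x \in s -> P x ->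
  exists m, P m /\ forall y, y \in s -> P y -> ~ (m < y)%O.
Proof.
elim: s x => // z s IHs x; rewrite inE => /predU1P xzs Px.
have [[w ws Pw]|nos] := pselect (exists2 w, w \in s & P w); last first.
  have eqz y : y \in z :: s -> P y -> y = z.
    by rewrite inE => /predU1P[//|ys] Py; case: nos; exists y.
  have xz : x = z by apply: eqz => //; rewrite inE; apply/predU1P.
  exists x; split=> // y ys Py.
  by rewrite (eqz y ys Py) xz ltxx.
have [m [Pm mmax]] := IHs w ws Pw.
have [[Pz mz]|nmz] := pselect (P z /\ (m < z)%O).
  exists z; split=> // y; rewrite inE => /predU1P[->|ys] Py; first by rewrite ltxx.
  by move=> zy; apply: (mmax y ys Py); apply: lt_trans zy.
exists m; split=> // y; rewrite inE => /predU1P[->|ys] Py; last exact: mmax.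
by move=> mz; case: nmz.
Qed.

Section Entries.
Variables (d : Order.disp_t) (X : porderType d) (K : fieldType).
Implicit Types (f g h : finc X K) (i j : incidence X K).

Lemma conv_single i j x y z :
  (forall w, i x w != 0 -> j w y != 0 -> w = z) ->
  conv i j x y = i x z * j z y.
Proof.
by move=> ijz; rewrite (@convE _ _ _ _ _ _ _ [:: z]) ?big_seq1 // => w *;
  rewrite inE; apply/eqP/ijz.
Qed.

Lemma conv_diag i j x : conv i j x x = i x x * j x x.
Proof.
apply: conv_single => w /inc_le xw /inc_le wx; apply: le_anti.
by rewrite xw wx.
Qed.

Lemma finc_mulE f g x y : (f * g) x y = conv f g x y.
Proof. by []. Qed.

Lemma finc_mul_diag f g x : (f * g) x x = f x x * g x x.
Proof. exact: conv_diag. Qed.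

Lemma delta_diag x : (1 : finc X K) x x = 1.
Proof. by rewrite [LHS]/= eqxx. Qed.

Lemma finc_unit_diag f g x : f * g = 1 -> f x x * g x x = 1.
Proof. by move=> fg; rewrite -finc_mul_diag fg delta_diag. Qed.

Lemma column_last f x b : (x < b)%O -> f x b != 0 ->
  exists a, [/\ (x <= a)%O, (a < b)%O, f a b != 0 &
    forall c, (a < c)%O -> (c < b)%O -> f c b = 0].
Proof.
move=> xb fxb; have [T _ hT] := finc_support f x b.
pose P a := [/\ (x <= a)%O, (a < b)%O & f a b != 0].
have PT a : P a -> a \in T.
  by case=> xa ab fab; have [] := hT a b xa (lexx b) _ fab; rewrite ?lt_eqF.
have Px : P x by split.
have [a [[xa ab fab] amax]] := seq_maximal (PT x Px) Px.
exists a; split=> // c ac cb; apply/eqP; apply: contraPT (ac) => fcb.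
have Pc : P c by split=> //; apply: le_trans xa (ltW ac).
by apply: (amax c (PT c Pc) Pc).
Qed.

(** The first endpoint is chosen maximal, then the second one minimal. *)
Lemma minimal_interval f : (forall x, f x x = 0) -> f != 0 ->
  exists a b, f a b != 0 /\
    forall c e, (a <= c)%O -> (e <= b)%O -> f c e != 0 -> c = a /\ e = b.
Proof.
move=> f0 fn0; have [x [y fxy]] : exists x y, f x y != 0.
  apply: contrapT => h; case/eqP: fn0; apply: fincP => x y.
  by apply/eqP; apply: contraPT (h) => fxy; apply; exists x, y.
have nd a b : f a b != 0 -> a != b.
  by apply: contra_neq => ->; rewrite f0.
have [T _ hT] := finc_support f x y.
pose P a := (x <= a)%O /\ exists2 b, (b <= y)%O & f a b != 0.
have PT a : P a -> a \in T.
  by case=> xa [b byy fab]; have [] := hT a b xa byy (nd _ _ fab) fab.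
have Px : P x by split=> //; exists y.
have [a [[xa [b0 b0y fab0]] amax]] := seq_maximal (PT x Px) Px.
pose Q b := (b <= y)%O /\ f a b != 0.
have QT b : Q b -> (b : X^d) \in (T : seq X^d).
  by case=> byy fab; have [] := hT a b xa byy (nd _ _ fab) fab.
have Qb0 : Q b0 by [].
have [b [[bley fab] bmin]] := @seq_maximal _ X^d T Q b0 (QT b0 Qb0) Qb0.
exists a, b; split=> // c e ac eb fce.
have ey : (e <= y)%O by exact: le_trans eb bley.
have ca : c = a.
  have Pc : P c by split; [exact: le_trans xa ac | exists e].
  have [//|nca] := eqVneq c a; case: (amax c (PT c Pc) Pc).
  by rewrite lt_neqAle eq_sym nca.
split=> //; rewrite ca in fce.
have Qe : Q e by [].
have [//|neb] := eqVneq e b; case: (bmin e (QT e Qe) Qe).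
by rewrite ltEdual lt_neqAle neb.
Qed.

End Entries.

(** * Matrix units and Dedekind finiteness *)

Section Units.
Variables (d : Order.disp_t) (X : porderType d) (K : fieldType).
Implicit Types (f g h : finc X K) (i j : incidence X K) (x y z : X).
Implicit Types a b : dinc X K.

(** At a minimal interval (x, y) of the support of g, the entry of P x * g * Q y
    is that of g. *)
Lemma sandwich_eq0 (P Q : X -> finc X K) g :
  (forall x, P x x x = 1) -> (forall y, Q y y y = 1) ->
  (forall x y, (P x * g * Q y) x y = 0) -> g = 0.
Proof.
move=> P1 Q1 PgQ; apply/eqP; apply: contraT => gn0.
have g0 x : g x x = 0.
  by have := PgQ x x; rewrite !finc_mul_diag P1 Q1 mul1r mulr1.
have [x [y [gxy gmin]]] := minimal_interval g0 gn0.
suff e : (P x * g * Q y) x y = g x y by rewrite -e PgQ eqxx in gxy.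
rewrite finc_mulE (@conv_single _ _ _ _ _ _ _ y) ?Q1 ?mulr1.
  rewrite finc_mulE (@conv_single _ _ _ _ _ _ _ x) ?P1 ?mul1r //.
  by move=> w /inc_le xw gwy; have [] := gmin _ _ xw (lexx y) gwy.
move=> w /conv_neq0[z [/inc_le xz gzw]] /inc_le wy.
by have [] := gmin _ _ xz wy gzw.
Qed.

Lemma idempotent_diag0 f : f * f = f -> (forall x, f x x = 0) -> f = 0.
Proof.
move=> ff f0; apply/eqP; apply: contraT => fn0.
have [x [y [fxy fmin]]] := minimal_interval f0 fn0.
have : (f * f) x y = 0.
  rewrite finc_mulE (@conv_single _ _ _ _ _ _ _ y) ?f0 ?mulr0 //.
  move=> w fxw /inc_le wy.
  by have [] := fmin _ _ (lexx x) wy fxw.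
by rewrite ff => e; rewrite e eqxx in fxy.
Qed.

(** The idempotent 1 - b a has a first component that vanishes on the diagonal, hence is
    zero, and D(X, K) has no nonzero idempotent in its second summand. *)
Lemma dinc_unitC a b : a * b = 1 -> b * a = 1.
Proof.
move=> ab1; have [p pE] : {p : dinc X K | p = 1 - b * a} by exists (1 - b * a).
have pp : p * p = p.
  rewrite {1}pE mulrBl mul1r -mulrA [X in _ - b * X](_ : _ = 0) ?mulr0 ?subr0 //.
  by rewrite pE mulrBr mulr1 mulrA ab1 mul1r subrr.
have p1 : p.1 = 0.
  apply: idempotent_diag0 => [|x]; first exact: (congr1 fst pp).
  have -> : p.1 = 1 - b.1 * a.1 by rewrite pE.
  rewrite fincDE [X in _ + X](_ : _ = - (b.1 * a.1) x x) // finc_mul_diag mulrC.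
  rewrite (@finc_unit_diag _ _ _ a.1) ?delta_diag ?subrr //.
  exact: (congr1 fst ab1).
suff p0 : p = 0 by apply/esym/subr0_eq; rewrite -pE.
rewrite -pp; case: p p1 {pE pp} => p1 p2 /= ->.
congr pair; first exact: mulr0.
by rewrite /= inc_mul0l inc_mul0r addr0.
Qed.

Fact munit_incidence x y :
  ((fun u v => [&& u == x, v == y & (x <= y)%O]%:R) : X -> X -> K^o)
    \in @incidence_pred d X K.
Proof. by apply/asboolP => u v; case: eqP => //= ->; case: eqP => //= -> /negbTE->. Qed.

Fact munit_finitary x y : Incidence (munit_incidence x y) \in @finitary_pred d X K.
Proof.
apply/asboolP => z t _; apply: (@sub_finite_set _ _ [set` [:: (x, y)]]%classic);
  last exact: finite_seq.
move=> [u v] [/= _ _ _ _]; rewrite inE.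
by case: (u =P x) => [->|]; case: (v =P y) => [->|] //=; rewrite ?eqxx.
Qed.

(** The matrix unit at (x, y), which vanishes unless x <= y. *)
Definition munit x y : finc X K := Finc (munit_finitary x y).

Lemma munitE x y u v : munit x y u v = [&& u == x, v == y & (x <= y)%O]%:R.
Proof. by []. Qed.

Lemma idemE x u v : idem K x u v = ((u == x) && (v == x))%:R.
Proof. by []. Qed.

Lemma idem_munit x : idem K x = munit x x.
Proof. by apply: fincP => u v; rewrite munitE lexx andbT. Qed.

Lemma inc_mul_idem_l x i u v : inc_mul (idem K x) i u v = (u == x)%:R * i u v.
Proof.
rewrite [LHS](@conv_single _ _ _ _ _ _ _ u) ?idemE ?andbb // => w.
by rewrite idemE; case: (u =P x) => [->|_]; case: (w =P x) => //=; rewrite eqxx.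
Qed.

Lemma inc_mul_idem_r x i u v : inc_mul i (idem K x) u v = i u v * (v == x)%:R.
Proof.
rewrite [LHS](@conv_single _ _ _ _ _ _ _ v) ?idemE ?andbb // => w _.
by rewrite idemE; case: (v =P x) => [->|_]; case: (w =P x) => //=; rewrite eqxx.
Qed.

Lemma inc_mul_idem2 x y i :
  inc_mul (inc_mul (idem K x) i) (idem K y) = ((i x y : K) *: munit x y : finc X K).
Proof.
apply: incP => u v; rewrite inc_mul_idem_r inc_mul_idem_l incZE munitE.
have [->|_] := eqVneq u x; last by rewrite !mul0r mulr0.
have [->|_] := eqVneq v y; last by rewrite !mulr0.
rewrite mulr1 mul1r /=; have [xy|/inc0->] := boolP (x <= y)%O.
  by rewrite mulr1.
by rewrite mul0r.
Qed.

Lemma idem_mul2 x y f : idem K x * f * idem K y = (f x y : K) *: munit x y.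
Proof. by apply: val_inj; exact: inc_mul_idem2. Qed.

Lemma idem_idem x : idem K x * idem K x = idem K x.
Proof.
by apply: fincP => u v; rewrite [LHS]inc_mul_idem_l idemE; case: (u =P x) => /= _;
  rewrite ?mul1r ?mul0r.
Qed.

Lemma idem_ortho x y : x != y -> idem K x * idem K y = 0.
Proof.
move=> xy; apply: fincP => u v; rewrite [LHS]inc_mul_idem_l idemE.
have [->|] := eqVneq u x; last by rewrite mul0r.
by rewrite (negbTE xy) mulr0.
Qed.

Lemma munit_mul x y z : (x <= y)%O -> (y <= z)%O -> munit x y * munit y z = munit x z.
Proof.
move=> xy yz; apply: fincP => u v; rewrite finc_mulE.
rewrite (@conv_single _ _ _ _ _ _ _ y).
  by rewrite !munitE xy yz (le_trans xy yz) !eqxx !andbT /=; case: (u =P x) => _;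
    rewrite ?mul1r ?mul0r.
by move=> w; rewrite munitE; case: (w =P y) => //; rewrite /= andbF eqxx.
Qed.

Lemma idem_munitl x y : idem K x * munit x y = munit x y.
Proof.
by apply: fincP => u v; rewrite [LHS]inc_mul_idem_l munitE; case: (u =P x) => /= _;
  rewrite ?mul1r ?mul0r.
Qed.

Lemma idem_munitr x y : munit x y * idem K y = munit x y.
Proof.
apply: fincP => u v; rewrite [LHS]inc_mul_idem_r munitE.
by case: (v =P y) => /= _; rewrite ?andbF ?mulr1 ?mulr0.
Qed.

(** The embeddings of the two summands of D(X, K), FI(X, K) as a subalgebra and
    I(X, K) as an ideal of square zero. *)
Definition dalg f : dinc X K := (f, 0).
Definition dmod i : dinc X K := (0, i).

Lemma dincP a b : a.1 = b.1 -> a.2 = b.2 -> a = b.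
Proof. by case: a b => [f i] [g j] /= -> ->. Qed.

Lemma dinc_split a : a = dalg a.1 + dmod a.2.
Proof. by apply: dincP; rewrite /= ?addr0 ?add0r. Qed.

Lemma dalgM f g : dalg (f * g) = dalg f * dalg g.
Proof. by apply: dincP; rewrite //= inc_mul0r inc_mul0l addr0. Qed.

Lemma dmodMl i a : dmod i * a = dmod (inc_mul i a.1).
Proof. by apply: dincP; [exact: mul0r | rewrite /= inc_mul0l add0r]. Qed.

Lemma dmodMr i a : a * dmod i = dmod (inc_mul a.1 i).
Proof. by apply: dincP; [exact: mulr0 | rewrite /= inc_mul0r addr0]. Qed.

Lemma dmodZ (k : K) i : dmod (k *: i) = k *: dmod i.
Proof. by apply: dincP; rewrite //= scaler0. Qed.

Lemma dalg_dmod1 f : dalg f * dmod (delta X K) = dmod f.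
Proof. by rewrite dmodMr inc_mul1r. Qed.

Lemma dalgidem_dmod x y i :
  dalg (idem K x) * dmod i * dalg (idem K y) = dmod ((i x y : K) *: munit x y : finc X K).
Proof. by rewrite dmodMr dmodMl inc_mul_idem2. Qed.

End Units.

(** * The matrix of the columns al(e_b) is finitary *)

Section Cut.
Local Open Scope classical_set_scope.

(** A fixed-point free map on an infinite set moves infinitely many points
    across some cut of the ambient set. *)
Lemma infinite_cut (T : choiceType) (B : set T) (a : T -> T) :
  ~ finite_set B -> (forall b, B b -> a b <> b) ->
  exists S : set T, ~ finite_set [set b | B b /\ ~ (S b <-> S (a b))].
Proof.
move=> Binf aB; apply: contrapT => /forallNP cutinf.
have cutfin S : finite_set [set b | B b /\ ~ (S b <-> S (a b))].
  exact: contrapT (cutinf S).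
(* Otherwise an edge {b, a b} can be chosen outside any finite set. *)
have /choice[fresh freshP] (F : seq T) : exists b, [/\ B b, b \notin F & a b \notin F].
  apply: contrapT => /forallNP h; apply: Binf.
  apply: (sub_finite_set (B := [set` F] `|`
    [set b | B b /\ ~ ([set` F] b <-> [set` F] (a b))])).
    move=> b Bb; have [bF|bF] := boolP (b \in F); [by left|right; split=> //].
    move=> [_ iab]; apply: (h b); split=> //; apply/negP => abF.
    by move: bF; rewrite [b \in F]iab.
  by rewrite finite_setU; split; [exact: finite_seq | exact: cutfin].
pose L := fix L n := if n is m.+1 then
  [:: fresh (L m), a (fresh (L m)) & L m] else [::].
pose b n := fresh (L n).
have bB n : B (b n) by case: (freshP (L n)).
have LS m n : (m < n)%N -> b m \in L n /\ a (b m) \in L n.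
  elim: n => // n IHn; rewrite ltnS leq_eqVlt => /predU1P[->|/IHn[bL abL]] /=.
    by rewrite !inE !eqxx orbT.
  by rewrite !inE bL abL !orbT.
have b_inj m n : (m < n)%N -> b m != b n.
  move=> /LS[bL _]; apply: contraTneq bL => ->.
  by case: (freshP (L n)).
pose S : set T := [set t | exists n, t = a (b n)].
have Sab n : S (a (b n)) by exists n.
have nSb n : ~ S (b n).
  move=> [m bn]; have [mn|nm|mn] := ltngtP m n.
  - have [_ abL] := LS m n mn; have [_ /negP] := freshP (L n).
    by rewrite -/(b n) bn.
  - have [bL _] := LS n m nm; have [_ _ /negP] := freshP (L m).
    by rewrite -/(b m) -bn.
  - by apply: (aB (b n)); rewrite // -mn -bn mn.
have /finite_seqP[s sE] := cutfin S.
have bs n : b n \in s.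
  have : [set b | B b /\ ~ (S b <-> S (a b))] (b n).
    by split=> // -[_ /(_ (Sab n))]; apply: nSb.
  by rewrite sE.
suff : (size (map b (iota 0 (size s).+1)) <= size s)%N.
  by rewrite size_map size_iota ltnn.
apply: uniq_leq_size => [|_ /mapP[n _ ->] //].
rewrite map_inj_in_uniq ?iota_uniq // => m n _ _ bmn.
by have [/b_inj|/b_inj|//] := ltngtP m n; rewrite bmn eqxx.
Qed.

End Cut.

Section Columns.
Local Open Scope classical_set_scope.
Variables (d : Order.disp_t) (X : porderType d) (K : fieldType).
Implicit Types (f g h : finc X K) (x y z : X).

Fact idems_incidence (S : set X) :
  ((fun u v => ((u == v) && `[<S u>])%:R) : X -> X -> K^o) \in @incidence_pred d X K.
Proof. by apply/asboolP => u v; case: (u =P v) => // ->; rewrite lexx. Qed.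

Fact idems_finitary S : Incidence (idems_incidence S) \in @finitary_pred d X K.
Proof.
apply/asboolP => x y _; apply: (sub_finite_set _ (finite_set0 _)) => -[u v] [/=].
by move=> _ _ _ /negbTE ->; rewrite eqxx.
Qed.

(** The diagonal idempotent supported by the set S. *)
Definition idems S : finc X K := Finc (idems_finitary S).

Lemma idemsE S u v : idems S u v = ((u == v) && `[<S u>])%:R.
Proof. by []. Qed.

Lemma inc_mul_idems_l S (i : incidence X K) u v :
  inc_mul (idems S) i u v = `[<S u>]%:R * i u v.
Proof.
rewrite [LHS](@conv_single _ _ _ _ _ _ _ u) ?idemsE ?eqxx // => w.
by rewrite idemsE; case: (u =P w) => //=; rewrite eqxx.
Qed.

Lemma inc_mul_idems_r S (i : incidence X K) u v :
  inc_mul i (idems S) u v = i u v * `[<S v>]%:R.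
Proof.
rewrite [LHS](@conv_single _ _ _ _ _ _ _ v) ?idemsE ?eqxx // => w _.
by rewrite idemsE; case: (w =P v) => //=; rewrite eqxx.
Qed.

Lemma idems_idem S x : idems S * idem K x = `[<S x>]%:R *: idem K x.
Proof.
apply: fincP => u v; rewrite [LHS]inc_mul_idems_l fincZE idemE.
by case: (u =P x) => [->//|_] /=; rewrite !mulr0.
Qed.

Section Column.
Variable al : finc X K -> finc X K.
Hypotheses (al_lin : linear al) (alM : forall f g, al (f * g) = al f * al g).
Hypothesis al_diag : forall x z, al (idem K x) z z = (z == x)%:R.

Let alZ (k : K) f : al (k *: f) = k *: al f.
Proof.
have al0 : al 0 = 0 by have := al_lin (-1) 0 0; rewrite scaler0 addr0 scaleN1r addNr.
by rewrite -[k *: f]addr0 al_lin al0 addr0.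
Qed.

Fact col_incidence :
  ((fun u v => al (idem K v) u v) : X -> X -> K^o) \in @incidence_pred d X K.
Proof. by apply/asboolP => u v /inc0. Qed.

(** If infinitely many columns v have a nonzero entry off the diagonal in the
    interval [x, y], let a v be the row of such an entry closest to the
    diagonal. For a set S that separates infinitely many v from a v, the
    entries of al(e_S) at the (a v, v) do not vanish. *)
Fact col_finitary : Incidence col_incidence \in @finitary_pred d X K.
Proof.
apply/asboolP => x y _; apply: contrapT => supp_inf.
pose B := [set v | exists u, [/\ (x <= u)%O, (u < v)%O, (v <= y)%O &
  al (idem K v) u v != 0]].
have Binf : ~ finite_set B.
  move=> Bfin; apply: supp_inf.
  apply: (@sub_finite_set _ _ (\bigcup_(v in B)
    [set p | p.2 = v /\ (x <= p.1)%O /\ (p.1 < v)%O /\ al (idem K v) p.1 v != 0])).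
    move=> [u v] [/= xu uv vy nuv auv].
    have uv' : (u < v)%O by rewrite lt_neqAle nuv.
    by exists v => //; exists u.
  apply: bigcup_finite => // v _; have [T _ hT] := finc_support (al (idem K v)) x v.
  apply: (@sub_finite_set _ _ [set` [seq (u, v) | u <- T]]); last exact: finite_seq.
  move=> [u w] [/= -> [xu [uv auv]]]; apply: map_f.
  by have [] := hT u v xu (lexx v) _ auv; rewrite ?lt_eqF.
have /choice[a aP] (v : X) : exists u, B v -> [/\ (x <= u)%O, (u < v)%O,
    (v <= y)%O, al (idem K v) u v != 0 &
    forall c, (u < c)%O -> (c < v)%O -> al (idem K v) c v = 0].
  have [Bv|] := pselect (B v); last by exists v.
  have [u [xu uv vy auv]] := Bv.
  have [c [uc cv acv cmax]] := column_last uv auv.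
  by exists c => _; split=> //; apply: le_trans xu uc.
have [|S] := @infinite_cut _ B a Binf.
  by move=> v Bv av; have [_] := aP v Bv; rewrite av ltxx.
apply; have [T _ hT] := finc_support (al (idems S)) x y.
apply: (@sub_finite_set _ _ [set` T]); last exact: finite_seq.
move=> v [Bv cutv]; have [xu uv vy auv amax] := aP v Bv.
suff aS : al (idems S) (a v) v != 0.
  by have [] := hT _ _ xu vy _ aS; rewrite ?lt_eqF.
(* Entry (a v, v) of al(e_S) al(e_v) = al(e_S e_v), where the sum has only two
   terms by the choice of a v. *)
have aSM z : al (idems S) * al (idem K z) = `[<S z>]%:R *: al (idem K z).
  by rewrite -alM idems_idem alZ.
have aSd z : al (idems S) z z = `[<S z>]%:R.
  have := congr1 (fun f : finc X K => f z z) (aSM z).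
  by rewrite finc_mul_diag fincZE al_diag eqxx !mulr1.
have e : al (idems S) (a v) v = (`[<S v>]%:R - `[<S (a v)>]%:R) * al (idem K v) (a v) v.
  have := congr1 (fun f : finc X K => f (a v) v) (aSM v).
  rewrite fincZE finc_mulE (@convE _ _ _ _ _ _ _ [:: a v; v]).
  - rewrite big_cons big_seq1 aSd al_diag eqxx mulr1 mulrBl => <-.
    by rewrite addrAC subrr add0r.
  - by rewrite /= inE (lt_eqF uv).
  move=> z /inc_le uz azv; have zv := inc_le azv.
  rewrite !inE; apply/norP => -[nzu nzv].
  by rewrite amax ?eqxx // lt_neqAle ?nzv // eq_sym nzu in azv.
rewrite e mulf_neq0 //; case: (pselect (S v)) (pselect (S (a v))) => Sv [] Sav.
- by case: cutv.
- by rewrite (asboolT Sv) (asboolF Sav) subr0 oner_eq0.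
- by rewrite (asboolF Sv) (asboolT Sav) sub0r oppr_eq0 oner_eq0.
- by case: cutv.
Qed.

(** The element whose b-th column is the b-th column of al(e_b). *)
Definition col : finc X K := Finc col_finitary.

End Column.
End Columns.

(** * Automorphisms of FI(X, K) *)

Section Conjugation.
Variable R : pzRingType.
Implicit Types u v a b : R.

Lemma conjM u v a b : v * u = 1 -> u * (a * b) * v = (u * a * v) * (u * b * v).
Proof. by move=> vu; rewrite -!mulrA (mulrA v u) vu mul1r. Qed.

Lemma conjK u v a : v * u = 1 -> v * (u * a * v) * u = a.
Proof. by move=> vu; rewrite !mulrA vu mul1r -mulrA vu mulr1. Qed.

Lemma inv_central u v : v * u = 1 -> (forall a, u * a = a * u) ->
  forall a, v * a = a * v.
Proof.
move=> vu uC a; have uv : u * v = 1 by rewrite uC.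
by rewrite -[a in LHS]mulr1 -uv (mulrA a) -uC !mulrA vu mul1r.
Qed.

End Conjugation.

Section InnerAut.
Variables (d : Order.disp_t) (X : porderType d) (K : fieldType).
Variable lambda : poset_involution X.
Implicit Types (f g h : finc X K) (x y z : X).

Lemma finc_unitC f g : f * g = 1 -> g * f = 1.
Proof.
move=> fg; have := @dinc_unitC _ X K (dalg f) (dalg g).
by rewrite -!dalgM fg => /(_ erefl) /(congr1 fst).
Qed.

Lemma rhoM f g : rho lambda (f * g) = rho lambda g * rho lambda f.
Proof. by apply: val_inj; apply: rho_inc_mul; apply: small_fincl. Qed.

Lemma rho_linear : linear (@rho _ X K lambda).
Proof. by move=> k f g; apply: fincP. Qed.

Lemma poset_inv_eq x y : (lambda x == lambda y) = (x == y).
Proof. by rewrite (inj_eq (can_inj (poset_invK lambda))). Qed.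

Lemma poset_inv_eqC x y : (lambda x == y) = (x == lambda y).
Proof. by rewrite -{1}[y](poset_invK lambda) poset_inv_eq. Qed.

Lemma rho_idem x : rho lambda (idem K x) = idem K (lambda x).
Proof.
apply: fincP => u v; rewrite [LHS]idemE idemE !poset_inv_eqC.
by rewrite andbC.
Qed.

Variable al : finc X K -> finc X K.
Hypotheses (al_lin : linear al) (alM : forall f g, al (f * g) = al f * al g).
Hypothesis al_diag : forall x z, al (idem K x) z z = (z == x)%:R.
Hypothesis al_munit : forall x y, (x <= y)%O -> al (munit K x y) != 0.

Let al0 : al 0 = 0.
Proof. by have := al_lin (-1) 0 0; rewrite scaler0 addr0 scaleN1r addNr. Qed.

Let alZ (k : K) f : al (k *: f) = k *: al f.
Proof. by rewrite -[k *: f]addr0 al_lin al0 addr0. Qed.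

Let al' f := rho lambda (al (rho lambda f)).

Let al'_lin : linear al'.
Proof. by move=> k f g; rewrite /al' rho_linear al_lin rho_linear. Qed.

Let al'M f g : al' (f * g) = al' f * al' g.
Proof. by rewrite /al' rhoM alM rhoM. Qed.

Let al'_diag x z : al' (idem K x) z z = (z == x)%:R.
Proof. by rewrite /al' rho_idem [LHS]al_diag poset_inv_eq. Qed.

(* ga is the matrix of the rows al(e_a) of al, obtained from the columns of the
   conjugate of al by the anti-automorphism rho. *)
Let be := col al_lin alM al_diag.
Let ga := rho lambda (col al'_lin al'M al'_diag).

Let beE u v : be u v = al (idem K v) u v. Proof. by []. Qed.

Let gaE u v : ga u v = al (idem K u) u v.
Proof.
transitivity (al' (idem K (lambda u)) (lambda v) (lambda u)); first by [].
by rewrite /al' rho_idem poset_invK /= !poset_invK.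
Qed.

Let al_idemM x y :
  al (idem K x) * al (idem K y) = if x == y then al (idem K x) else 0.
Proof.
by rewrite -alM; case: eqVneq => [->|xy]; rewrite ?idem_idem ?idem_ortho.
Qed.

Let gabe : ga * be = 1.
Proof.
apply: fincP => x z; transitivity ((al (idem K x) * al (idem K z)) x z).
  by apply: eq_fsbigr => w _; rewrite gaE.
rewrite al_idemM [RHS]/=; case: eqVneq => // ->.
by rewrite al_diag eqxx.
Qed.

Let bega : be * ga = 1. Proof. exact: finc_unitC gabe. Qed.

Let al_idem_be x : al (idem K x) * be = be * idem K x.
Proof.
apply: fincP => u v; rewrite [RHS]inc_mul_idem_r.
transitivity ((al (idem K x) * al (idem K v)) u v); first by [].
rewrite al_idemM beE eq_sym; case: eqVneq => [->|]; first by rewrite mulr1.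
by rewrite mulr0.
Qed.

Let mu f := ga * al f * be.

Let mu_idem x : mu (idem K x) = idem K x.
Proof. by rewrite /mu -mulrA al_idem_be mulrA gabe mul1r. Qed.

Let muM f g : mu (f * g) = mu f * mu g.
Proof.
by rewrite /mu alM conjM // bega. Qed.

Let muZ (k : K) f : mu (k *: f) = k *: mu f.
Proof. by rewrite /mu alZ -finc_scaleAr -finc_scaleAl. Qed.

Let muE f u v : mu f u v = mu (munit K u v) u v * f u v.
Proof.
have e : idem K u * mu f * idem K v = mu ((f u v : K) *: munit K u v).
  by rewrite -idem_mul2 !muM !mu_idem.
have := congr1 (fun g : finc X K => g u v) e; rewrite muZ fincZE mulrC => <-.
by rewrite finc_mulE [RHS]inc_mul_idem_r [X in X * _]inc_mul_idem_l !eqxx mulr1 mul1r.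
Qed.

Let mu_munit u v : mu (munit K u v) = (mu (munit K u v) u v : K) *: munit K u v.
Proof.
have e : idem K u * mu (munit K u v) * idem K v = mu (munit K u v).
  by rewrite -{1}(mu_idem u) -{1}(mu_idem v) -!muM idem_munitl idem_munitr.
by rewrite -{1}e idem_mul2.
Qed.

Fact sigma_incidence :
  ((fun u v => mu (munit K u v) u v) : X -> X -> K^o) \in @incidence_pred d X K.
Proof. by apply/asboolP => u v /inc0. Qed.

Let sigma := Incidence sigma_incidence.

Let sigma_mult : multiplicative_inc sigma.
Proof.
have sE u v : sigma u v = mu (munit K u v) u v by [].
split=> [x y xy|x y z xy yz]; rewrite ?sE.
  apply/eqP => s0; have := mu_munit x y; rewrite s0 scale0r => m0.
  case/eqP: (al_munit xy).
  have : be * mu (munit K x y) * ga = 0 by rewrite m0 mulr0 mul0r.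
  by rewrite /mu conjK.
rewrite -(munit_mul K xy yz) muM finc_mulE.
rewrite (@conv_single _ _ _ _ _ _ _ y) // => w.
by rewrite mu_munit fincZE munitE; case: (w =P y) => //; rewrite andbF mulr0 eqxx.
Qed.

(** Conjugation by the matrix of the columns al(e_b) turns al into an
    automorphism fixing every e_x, that is, a multiplicative one. *)
Lemma endo_inner
    (hmult : forall s : incidence X K, multiplicative_inc s -> inner_aut (mult_aut s)) :
  inner_aut al.
Proof.
have [u [v [uv vu uvE]]] := hmult sigma sigma_mult.
exists (be * u), (v * ga); split.
- by rewrite mulrA -(mulrA be) uv mulr1 bega.
- by rewrite mulrA -(mulrA v) gabe mulr1 vu.
move=> f; have e : mu f = u * f * v.
  by rewrite -uvE; apply: fincP => x y; rewrite muE.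
have -> : al f = be * mu f * ga by rewrite /mu conjK.
by rewrite e !mulrA.
Qed.

End InnerAut.

(** * The centre of D(X, K) *)

Section Center.
Variables (d : Order.disp_t) (X : porderType d) (K : fieldType).
Implicit Types (f g h : finc X K) (i j : incidence X K) (x y z : X).
Implicit Types a b : dinc X K.

(** The central element k + m t, where t is the unity of FI(X, K) seen in I(X, K). *)
Definition dscal (k m : K) : dinc X K :=
  (k *: delta X K, m *: (delta X K : incidence X K)).

Lemma dscalE k m : dscal k m = k *: dalg (delta X K) + m *: dmod (delta X K).
Proof. by apply: dincP; rewrite /= scaler0 ?addr0 ?add0r. Qed.

Lemma dscalMl k m a : dscal k m * a = k *: a + m *: dmod a.1.
Proof.
rewrite dscalE mulrDl -!dinc_scaleAl dmodMl inc_mul1l.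
by rewrite (mul1r a : dalg (delta X K) * a = a).
Qed.

Lemma dscalC k m a : dscal k m * a = a * dscal k m.
Proof.
rewrite dscalMl dscalE mulrDr -!dinc_scaleAr dmodMr inc_mul1r.
by rewrite (mulr1 a : a * dalg (delta X K) = a).
Qed.

Lemma dscalM k m k' m' : dscal k m * dscal k' m' = dscal (k * k') (k * m' + m * k').
Proof.
rewrite dscalMl; apply: dincP; first by rewrite /= scaler0 addr0 scalerA.
apply: incP => x y; rewrite [RHS]incZE mulrDl -!mulrA.
exact: erefl.
Qed.

Lemma dscal1 : dscal 1 0 = 1.
Proof. by rewrite dscalE scale1r scale0r addr0. Qed.

Lemma central_entries i : (forall f, inc_mul f i = inc_mul i f) ->
  (forall x y, x != y -> i x y = 0) /\
  (forall x y, (x <= y)%O -> i x x = i y y).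
Proof.
move=> iC; split=> [x y xy|x y xy].
  have := congr1 (fun j : incidence X K => j x y) (iC (idem K x)).
  by rewrite inc_mul_idem_l inc_mul_idem_r eqxx mul1r eq_sym (negbTE xy) mulr0.
have := congr1 (fun j : incidence X K => j x y) (iC (munit K x y)).
rewrite [LHS](@conv_single _ _ _ _ _ _ _ y); last first.
  by move=> w; rewrite munitE; case: (w =P y) => //=; rewrite andbF eqxx.
rewrite [RHS](@conv_single _ _ _ _ _ _ _ x); last first.
  by move=> w _; rewrite munitE; case: (w =P x) => //=; rewrite eqxx.
by rewrite munitE !eqxx xy mul1r mulr1.
Qed.

Lemma central_scalar i x : connected_poset X ->
  (forall f, inc_mul f i = inc_mul i f) ->
  i = ((i x x : K) *: delta X K : finc X K).
Proof.
move=> Xconn /central_entries[offdiag diag].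
have ixx y : i y y = i x x.
  have [p + <-] := Xconn x y; elim: p x {y} => //= z p IHp x /andP[xz pz].
  by rewrite IHp //; case/orP: xz => /diag ->.
apply: incP => y z; rewrite incZE /=.
by have [->|yz] := eqVneq y z; rewrite ?ixx ?mulr1 // offdiag // mulr0.
Qed.

Lemma dinc_central_scalar a x : connected_poset X ->
  (forall b, a * b = b * a) -> a = dscal (a.1 x x : K) (a.2 x x : K).
Proof.
move=> Xconn aC; apply: dincP.
  apply: val_inj; apply: central_scalar => // f.
  exact/esym/(congr1 (fun b : dinc X K => finc_val b.1) (aC (dalg f))).
apply: central_scalar => // f.
by have := congr1 snd (aC (dalg f)); rewrite /= inc_mul0l inc_mul0r addr0 add0r.
Qed.

End Center.

(** * Automorphisms of D(X, K) *)

Section DincAut.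
Variables (d : Order.disp_t) (X : porderType d) (K : fieldType).
Implicit Types (f g h : finc X K) (i j : incidence X K) (x y z : X).
Implicit Types a b : dinc X K.

(** Scaling of the second summand, an automorphism of D(X, K) for c != 0. *)
Definition dtwist (c : K) a : dinc X K := (a.1, c *: a.2).

Variables (lambda : poset_involution X) (x0 : X).
Hypothesis Xconn : connected_poset X.
Hypothesis hmult : forall s : incidence X K,
  multiplicative_inc s -> inner_aut (mult_aut s).
Hypothesis hder : forall D : finc X K -> incidence X K,
  is_derivation D -> inner_derivation D.

Variable Om : dinc X K -> dinc X K.
Hypotheses (Om_lin : linear Om) (OmM : forall a b, Om (a * b) = Om a * Om b).
Hypotheses (Om_inj : injective Om) (Om_surj : forall b, exists a, Om a = b).
Hypothesis Om_diag : forall x z, (Om (dalg (idem K x))).1 z z = (z == x)%:R.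

Let Om0 : Om 0 = 0.
Proof. by have := Om_lin (-1) 0 0; rewrite scaler0 addr0 scaleN1r addNr. Qed.

Let c : K := (Om (dmod (delta X K))).2 x0 x0.

Let Om_t : Om (dmod (delta X K)) = c *: dmod (delta X K).
Proof.
have tC a : dmod (delta X K) * a = a * dmod (delta X K).
  by rewrite dmodMl dmodMr inc_mul1l inc_mul1r.
have := @dinc_central_scalar _ X K (Om (dmod (delta X K))) x0 Xconn.
pose k : K := (Om (dmod (delta X K))).1 x0 x0; rewrite -/c -/k => e.
have Omt : Om (dmod (delta X K)) = dscal X k c.
  by apply: e => b; have [a <-] := Om_surj b; rewrite -!OmM tC.
have k0 : k = 0.
  have : dscal X k c * dscal X k c = 0.
    by rewrite -Omt -OmM dmodMl inc_mul0r -[RHS]Om0.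
  rewrite dscalM => /(congr1 (fun a : dinc X K => a.1 x0 x0)).
  rewrite [LHS]fincZE (delta_diag K x0 : delta X K x0 x0 = 1) mulr1 => /eqP.
  by rewrite mulf_eq0 orbb => /eqP.
by rewrite Omt k0 dscalE scale0r add0r.
Qed.

Let al f := (Om (dalg f)).1.

Let dalg_linear (k : K) f g : dalg (k *: f + g) = k *: dalg f + dalg g.
Proof. by apply: dincP; rewrite //= scaler0 addr0. Qed.

Let al_lin : linear al.
Proof. by move=> k f g; rewrite /al dalg_linear Om_lin. Qed.

Let alM f g : al (f * g) = al f * al g.
Proof. by rewrite /al dalgM OmM. Qed.

Let Om_dmod_finc f : Om (dmod f) = dmod ((c *: al f : finc X K)).
Proof.
rewrite -dalg_dmod1 OmM Om_t -dinc_scaleAr dmodMr inc_mul1r.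
by rewrite -dmodZ.
Qed.

Let al_munit x y : (x <= y)%O -> al (munit K x y) != 0.
Proof.
move=> xy; apply/eqP => m0; have /Om_inj : Om (dmod (munit K x y)) = Om 0.
  by rewrite Om_dmod_finc m0 scaler0 Om0.
move=> /(congr1 (fun a : dinc X K => a.2 x y)) /= /eqP.
by rewrite !eqxx xy oner_eq0.
Qed.

Let Om_dmod1 i : (Om (dmod i)).1 = 0.
Proof.
apply: (@sandwich_eq0 _ _ _ (al \o @idem _ X K) (al \o @idem _ X K)) => [x|y|x y].
- by rewrite /= Om_diag eqxx.
- by rewrite /= Om_diag eqxx.
transitivity ((Om (dalg (idem K x)) * Om (dmod i) * Om (dalg (idem K y))).1 x y).
  by [].
by rewrite -!OmM dalgidem_dmod Om_dmod_finc.
Qed.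

(** Under the hypotheses on multiplicative automorphisms and derivations, an
    automorphism of D(X, K) that preserves the diagonals of the e_x is a scaling of the
    second summand followed by a conjugation. *)
Lemma dinc_aut_inner : exists (w w' : dinc X K) (c : K),
  w * w' = 1 /\ forall a, Om a = w * dtwist c a * w'.
Proof.
have [u [v [uv vu uvE]]] :=
  @endo_inner _ _ _ lambda al al_lin alM Om_diag al_munit hmult.
have UV : dalg u * dalg v = 1 by rewrite -dalgM uv.
have VU : dalg v * dalg u = 1 by rewrite -dalgM vu.
pose Om' a := dalg v * Om a * dalg u.
have OmE a : Om a = dalg u * Om' a * dalg v by rewrite /Om' conjK.
have Om'M a b : Om' (a * b) = Om' a * Om' b by rewrite /Om' OmM conjM.
have Om'L : linear Om'.
  move=> k a b; rewrite /Om' Om_lin mulrDr mulrDl.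
  by rewrite -dinc_scaleAr -dinc_scaleAl.
have Om'1 f : (Om' (dalg f)).1 = f.
  transitivity (v * al f * u); first by [].
  by rewrite uvE conjK.
have Om'_finc f : Om' (dmod f) = dmod ((c *: f : finc X K)).
  have -> : dmod f = dalg f * dmod (delta X K) by rewrite dalg_dmod1.
  rewrite Om'M [Om' (dmod _)](_ : _ = c *: dmod (delta X K)).
    by rewrite -dinc_scaleAr dmodMr inc_mul1r Om'1 -dmodZ.
  rewrite /Om' Om_t -dinc_scaleAr -dinc_scaleAl dalg_dmod1 dmodMl.
  by rewrite (congr1 (@finc_val _ X K) vu : inc_mul v u = delta X K).
have Om'2 i : Om' (dmod i) = dmod (c *: i).
  have [j jE] : exists j, Om' (dmod i) = dmod j.
    exists (Om' (dmod i)).2; apply: dincP => //.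
    by rewrite [LHS]/= Om_dmod1 mulr0 mul0r.
  rewrite jE; congr dmod; apply: incP => x y.
  have : dalg (idem K x) * dmod j * dalg (idem K y) =
      Om' (dalg (idem K x) * dmod i * dalg (idem K y)).
    by rewrite !Om'M jE !dmodMr !dmodMl !Om'1.
  rewrite dalgidem_dmod dalgidem_dmod Om'_finc => /(congr1 (fun a : dinc X K => a.2 x y)).
  have [xy|nxy] := boolP (x <= y)%O; last by rewrite !inc0.
  have m1 : munit K x y x y = 1 by rewrite munitE !eqxx xy.
  by rewrite [LHS]fincZE [RHS]fincZE fincZE m1 !mulr1.
pose D f := (Om' (dalg f)).2.
have [|j jE] := hder (D := D).
  split=> [k f g|f g]; first by rewrite /D dalg_linear Om'L.
  rewrite {1}/D dalgM Om'M addrC.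
  transitivity (inc_mul (Om' (dalg f)).1 (D g) + inc_mul (D f) (Om' (dalg g)).1).
    by [].
  by rewrite !Om'1.
pose j1 : dinc X K := (delta X K, -j); pose j2 : dinc X K := (delta X K, j).
(* The derivation D is undone by conjugation by the unipotent element (1, -j). *)
have jj : j1 * j2 = 1.
  apply: dincP; first exact: mul1r.
  by rewrite /= inc_mul1l inc_mul1r addrN.
exists (dalg u * j1), (j2 * dalg v), c; split=> //.
  by rewrite mulrA -(mulrA (dalg u)) jj mulr1.
move=> a; rewrite OmE !mulrA -!mulrA; congr (_ * _); rewrite !mulrA; congr (_ * _).
have -> : dalg v * Om a * dalg u = Om' (dalg a.1) + Om' (dmod a.2).
  rewrite {1}(dinc_split a) -/(Om' _).
  by have := Om'L 1 (dalg a.1) (dmod a.2); rewrite !scale1r.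
have -> : Om' (dalg a.1) = (a.1, D a.1) by apply: dincP; rewrite ?Om'1.
rewrite Om'2 jE; apply: dincP.
  rewrite [LHS]addr0 [RHS]mulr1; exact/esym/mul1r.
rewrite /=.
rewrite inc_mul1l inc_mul1r inc_mul1l [RHS]addrC -addrA addrC; congr (_ + _).
rewrite addrC; congr (_ + _).
have := inc_mul_lin_l (-1) (small_fincr j a.1) (small_fincr 0 a.1).
by rewrite inc_mul0l !addr0 !scaleN1r => ->.
Qed.

End DincAut.

(** * Symmetric units of a ring with involution *)

Section SymmetricUnit.
Variables (R : pzRingType) (tau : R -> R).
Hypotheses (tauM : forall a b, tau (a * b) = tau b * tau a) (tauK : involutive tau).
Implicit Types a b : R.

Lemma anti_involution1 : tau 1 = 1.
Proof. by rewrite -[tau 1]mulr1 -{2}[1]tauK -tauM mulr1 tauK. Qed.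

Variables q v : R.
Hypotheses (qv : q * v = 1) (vq : v * q = 1).

Let tauqE : tau q = q * (v * tau q).
Proof. by rewrite mulrA qv mul1r. Qed.

(** If a |-> v tau(a) q is an involution then tau(q) is q up to the central unit
    v tau(q). *)
Lemma involution_twist_central : (forall a, v * tau (v * tau a * q) * q = a) ->
  forall a, v * tau q * a = a * (v * tau q).
Proof.
move=> PhiK a; have tvq : tau v * tau q = 1 by rewrite -tauM qv anti_involution1.
have e : v * tau q * a * (tau v * q) = a.
  by rewrite -{2}[a]PhiK !tauM tauK !mulrA.
by rewrite -{2}e -!mulrA (mulrA q) qv mul1r tvq mulr1.
Qed.

Hypothesis zC : forall a, v * tau q * a = a * (v * tau q).
Variables y y' e : R.
Hypotheses (y'y : y' * y = 1) (yC : forall a, y * a = a * y).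
Hypothesis tyC : forall a, tau y * a = a * tau y.
Hypotheses (taue : tau e = e) (corner : e * q * e = y * e).

Lemma corner_twist : tau y * e = v * tau q * y * e.
Proof.
have [z zE] : {z | z = v * tau q} by eexists.
have zC' a : z * a = a * z by rewrite zE zC.
have tq : tau q = q * z by rewrite zE.
rewrite -zE tyC -{1}taue -tauM -corner !tauM taue tq.
by rewrite -(zC' q) !mulrA -(zC' e) -[RHS]mulrA -corner !mulrA.
Qed.

Hypothesis tyE : tau y = v * tau q * y.

Let yy' : y * y' = 1. Proof. by rewrite yC. Qed.

Let y'C a : y' * a = a * y'. Proof. exact: inv_central y'y yC a. Qed.

(** Dividing q by y absorbs the central unit by which tau(q) and q differ. *)
Lemma scaled_symmetric : tau (y' * q) = y' * q.
Proof.
have ty'y : tau y' * tau y = 1 by rewrite -tauM yy' anti_involution1.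
have y'E : y' = tau y' * (v * tau q).
  by rewrite -[LHS]mul1r -ty'y tyE -!mulrA yy' mulr1.
have ty'C a : tau y' * a = a * tau y'.
  by rewrite -[a in RHS]tauK -tauM y'C tauM tauK.
by rewrite tauM tauqE -zC -ty'C mulrA -y'E.
Qed.

(** Conjugation by s carries the involution a |-> v tau(a) q to tau. *)
Lemma conj_transfer s t : tau s * s = y' * q -> s * t = 1 ->
  forall a, s * (v * tau a * q) * t = tau (s * a * t).
Proof.
move=> ss st a; have ts1 : tau t * tau s = 1 by rewrite -tauM st anti_involution1.
have sv : s * v = tau t * y'.
  by rewrite -[LHS]mul1r -ts1 -mulrA (mulrA (tau s)) ss -[y' * q * v]mulrA qv mulr1.
have qt : q * t = y * tau s.
  by rewrite -[q]mul1r -yy' -(mulrA y) -ss -!mulrA st mulr1.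
rewrite !mulrA sv -(mulrA _ q) qt !tauM -!mulrA y'C.
by rewrite -!mulrA (mulrA y) yC -mulrA yy' mulr1.
Qed.

End SymmetricUnit.

Section BlockFactorization.
Variables (R : pzRingType) (tau : R -> R).
Hypotheses (tauD : forall a b, tau (a + b) = tau a + tau b).
Hypotheses (tauM : forall a b, tau (a * b) = tau b * tau a).
Hypothesis tauK : involutive tau.
Variables e0 e1 e2 h q w : R.
Hypotheses (esum : e1 + e0 + e2 = 1) (tau0 : tau e0 = e0) (tau1 : tau e1 = e2).
Hypotheses (e11 : e1 * e1 = e1) (e10 : e1 * e0 = 0) (e12 : e1 * e2 = 0).
Hypotheses (e00 : e0 * e0 = e0) (e02 : e0 * e2 = 0) (e22 : e2 * e2 = e2).
Hypotheses (lo01 : forall a, e0 * a * e1 = 0) (lo20 : forall a, e2 * a * e0 = 0).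
Hypothesis lo21 : forall a, e2 * a * e1 = 0.
Hypotheses (hC : forall a, h * a = a * h) (hh : h + h = 1) (tauh : tau h = h).
Hypotheses (qw : q * w = 1) (wq : w * q = 1) (tauq : tau q = q) (q0 : e0 * q * e0 = e0).

(** A symmetric unit q that is block triangular for e1, e0, e2, with middle block e0,
    where the involution swaps the outer blocks, is tau(s) s for a triangular s. The
    rows of s through e0 and e2 are those of q, and its row through e1 is 1 plus the
    correction that fixes the corner block m, halved because it occurs twice. *)
Lemma symmetric_unit_factor : exists s, tau s * s = q.
Proof.
have tau2 : tau e2 = e1 by rewrite -tau1 tauK.
have tau_1 : tau 1 = 1 by rewrite -[tau 1]mulr1 -{2}[1]tauK -tauM mulr1 tauK.
have tauw : tau w = w.
  have e : tau w * q = 1 by rewrite -{1}tauq -tauM qw.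
  by rewrite -[tau w]mulr1 -qw mulrA e mul1r.
have tau_0 : tau 0 = 0 by apply: (addrI (tau 0)); rewrite -tauD !addr0.
have tauN a : tau (- a) = - tau a.
  by apply: (addrI (tau a)); rewrite -tauD !addrN.
have we1 : e1 * w * e1 = w * e1.
  by rewrite -[RHS]mul1r -esum !mulrDl !mulrA lo01 lo21 !addr0.
have e2w : e2 * w * e2 = e2 * w.
  by rewrite -[RHS]mulr1 -esum !mulrDr lo21 lo20 !add0r.
have [m mE] : {m | m = e1 * q * e2 - e1 * q * e0 * q * e2} by eexists.
have taum : tau m = m.
  by rewrite mE tauD tauN !tauM tau1 tau2 tau0 tauq !mulrA.
have e1m : e1 * m = m by rewrite mE mulrBr !mulrA e11.
have me2 : m * e2 = m by rewrite mE mulrBl -!mulrA e22.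
pose s := e1 + e0 * q + e2 * q + h * (e1 * w * m).
have taus : tau s = e2 + q * e0 + q * e1 + h * (m * w * e2).
  by rewrite /s !tauD !tauM tau0 tau1 tau2 taum tauw tauq tauh -hC !mulrA.
exists s; rewrite taus.
have e1s : e1 * s = e1 + h * (e1 * w * m).
  by rewrite /s !mulrDr !mulrA e11 e10 e12 !mul0r !addr0 -(hC e1)
    -!mulrA (mulrA e1 e1) e11.
have e01 : e0 * e1 = 0 by have := lo01 1; rewrite mulr1.
have e20 : e2 * e0 = 0 by have := lo20 1; rewrite mulr1.
have e21 : e2 * e1 = 0 by have := lo21 1; rewrite mulr1.
have e0s : e0 * s = e0 * q.
  by rewrite /s !mulrDr !mulrA e01 e00 e02 -(hC e0)
    -!mulrA (mulrA e0 e1) e01 !mul0r mulr0 add0r !addr0.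
have e2s : e2 * s = e2 * q.
  by rewrite /s !mulrDr !mulrA e21 e20 e22 -(hC e2)
    -!mulrA (mulrA e2 e1) e21 !mul0r mulr0 !add0r addr0.
have qm : q * e1 * w * m = m.
  rewrite -{1}e1m !mulrA -(mulrA q e1) -(mulrA q) we1 mulrA qw mul1r.
  exact: e1m.
have mq : m * w * e2 * q = m.
  rewrite -{1}me2 -(mulrA m e2) -(mulrA m) e2w -!mulrA wq mulr1.
  exact: me2.
have -> : (e2 + q * e0 + q * e1 + h * (m * w * e2)) * s =
    e2 * s + q * (e0 * s) + q * (e1 * s) + h * (m * w * (e2 * s)).
  by rewrite !mulrDl !mulrA.
rewrite e0s e1s e2s mulrDr.
have -> : q * (h * (e1 * w * m)) = h * m.
  by rewrite mulrA -hC -mulrA !mulrA -(mulrA h) -(mulrA h) -(mulrA h) qm.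
have -> : m * w * (e2 * q) = m by rewrite mulrA.
have qe1 : q * e1 = e1 * q * e1.
  by rewrite -[LHS]mul1r -esum !mulrDl !mulrA lo01 lo21 !addr0.
have qe0 : q * e0 = e1 * q * e0 + e0.
  by rewrite -[LHS]mul1r -esum !mulrDl !mulrA q0 lo20 addr0.
have e0q : e0 * q = e0 + e0 * q * e2.
  by rewrite -[LHS]mulr1 -esum !mulrDr lo01 q0 add0r.
have e1q : e1 * q = e1 * q * e1 + e1 * q * e0 + e1 * q * e2.
  by rewrite -!mulrDr esum mulr1.
have -> : q * (e0 * q) =
    e1 * q * e0 + e1 * q * e0 * q * e2 + e0 * q.
  rewrite mulrA qe0 mulrDl; congr (_ + _).
  by rewrite -[LHS]mulrA e0q mulrDr !mulrA.
rewrite -addrA -[q * e1 + _ + _]addrA -mulrDl hh mul1r mE qe1.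
rewrite -[RHS]mul1r -esum !mulrDl [in RHS]e1q !addrA.
by rewrite [LHS](ACl (5*2*6*4*1*(3*7))) /= addrN addr0.
Qed.

End BlockFactorization.

(** * Splitting a poset along an involution *)

Section Splitting.
Local Open Scope classical_set_scope.
Variables (d : Order.disp_t) (X : porderType d) (lambda : poset_involution X).

(** The complement of the fixed points of an involution on a poset is the disjoint union
    of a down-set and its image. *)
Lemma involution_splitting : exists S : set X,
  [/\ forall x y, (x <= y)%O -> S y -> S x, forall x, S x -> ~ S (lambda x) &
      forall x, lambda x != x -> S x \/ S (lambda x)].
Proof.
pose P (S : set X) := (forall x y, (x <= y)%O -> S y -> S x) /\
  (forall x, S x -> ~ S (lambda x)).
have [F FP Ftot|S [[Sdown Sdisj] Smax]] := @Zorn_bigcup X P.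
  split=> [x y xy [A FA Ay]|x [A FA Ax] [B FB Bx]].
    by exists A => //; have [Ad _] := FP _ FA; apply: Ad xy Ay.
  have [AB|BA] := Ftot A B FA FB.
    by have [_ /(_ _ (AB _ Ax))] := FP _ FB.
  by have [_ /(_ _ Ax (BA _ Bx))] := FP _ FA.
have le_swap x y : (lambda x <= y)%O -> (lambda y <= x)%O.
  by rewrite (poset_inv_le lambda) poset_invK.
(* Adding the elements below x keeps the down-set disjoint from its image. *)
have extend x : ~ (lambda x <= x)%O -> ~ S x -> ~ S (lambda x) -> False.
  move=> nlx nSx nSlx; apply: (Smax (S `|` [set y | (y <= x)%O])).
    by split=> [|/(_ x)]; [exact: subsetUl | move/(_ (or_intror (lexx x)))].
  split=> [y z yz [Sz|zx]|y [Sy|yx] [Sly|lyx]].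
  - by left; apply: Sdown yz Sz.
  - by right; apply: le_trans yz zx.
  - exact: Sdisj Sy Sly.
  - by apply: nSlx; apply: Sdown Sy; apply: le_swap.
  - by apply: nSlx; apply: Sdown Sly; rewrite -poset_inv_le.
  - by apply: nlx; apply: le_trans (le_swap _ _ lyx) yx.
exists S; split=> // x lx; apply: contrapT => /not_orP[nSx nSlx].
have [lex|nlex] := pselect (lambda x <= x)%O; last exact: extend x nlex nSx nSlx.
apply: (extend (lambda x)); rewrite ?poset_invK //.
by move=> xle; case/eqP: lx; apply: le_anti; rewrite lex xle.
Qed.

End Splitting.

(** * Equivalence of involutions *)

Section Normalization.
Variables (d : Order.disp_t) (X : porderType d) (K : fieldType).
Implicit Types (f g : finc X K) (i j : incidence X K) (x y z : X).
Implicit Types (a b : dinc X K) (S T : set X).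

Lemma dalg_mull f a : dalg f * a = (f * a.1, inc_mul f a.2).
Proof. by apply: dincP; rewrite //= inc_mul0l addr0. Qed.

Lemma dalg_mulr f a : a * dalg f = (a.1 * f, inc_mul a.2 f).
Proof. by apply: dincP; rewrite //= inc_mul0r add0r. Qed.

(** The diagonal idempotent of the set S in D(X, K). *)
Definition didems S : dinc X K := dalg (idems K S).

Lemma didems_mul0 S T a : (forall x y, S x -> T y -> ~ (x <= y)%O) ->
  didems S * a * didems T = 0.
Proof.
move=> ST; have e x y i : `[<S x>]%:R * i x y * `[<T y>]%:R = 0.
  case: asboolP => Sx; rewrite ?mul0r //; case: asboolP => Ty; rewrite ?mulr0 //.
  by rewrite inc0 ?mulr0 ?mul0r //; apply/negP; apply: ST.
rewrite /didems dalg_mull dalg_mulr; apply: dincP.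
  by apply: fincP => x y; rewrite [LHS]inc_mul_idems_r inc_mul_idems_l e.
by apply: incP => x y; rewrite [LHS]inc_mul_idems_r inc_mul_idems_l e.
Qed.

Lemma didemsM S T : didems S * didems T = didems (S `&` T)%classic.
Proof.
rewrite /didems -dalgM; congr dalg; apply: fincP => x y.
rewrite [LHS]inc_mul_idems_l !idemsE.
have -> : `[<(S `&` T)%classic x>] = `[<S x>] && `[<T x>].
  apply/asboolP/andP => -[] => [Sx Tx|/asboolP Sx /asboolP Tx]; split=> //;
    exact/asboolP.
by case: (x == y); case: `[<S x>]; case: `[<T x>]; rewrite ?mulr0 ?mul0r ?mulr1.
Qed.

Lemma dscal_didem k m x (a := dscal X k m) :
  (a * dalg (idem K x)).1 x x = k /\ (a * dalg (idem K x)).2 x x = m.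
Proof.
rewrite /a dscalMl; split.
  rewrite [LHS]fincDE fincZE idemE eqxx mulr1 [X in _ + X](_ : _ = 0) ?addr0 //.
  exact: mulr0.
rewrite [LHS]incDE [X in X + _](_ : _ = 0) ?add0r; last exact: mulr0.
by rewrite [LHS]incZE idemE eqxx mulr1.
Qed.

Lemma dscal_idem_inj k m k' m' x :
  dscal X k m * dalg (idem K x) = dscal X k' m' * dalg (idem K x) ->
  dscal X k m = dscal X k' m'.
Proof.
have [kE mE] := dscal_didem k m x; have [kE' mE'] := dscal_didem k' m' x => e.
have <- := etrans (esym kE) (etrans (congr1 (fun a : dinc X K => a.1 x x) e) kE').
by have <- := etrans (esym mE) (etrans (congr1 (fun a : dinc X K => a.2 x x) e) mE').
Qed.

Lemma didem_corner x a : dalg (idem K x) * a * dalg (idem K x) =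
  dscal X (a.1 x x : K) (a.2 x x : K) * dalg (idem K x).
Proof.
rewrite dscalMl dalg_mull dalg_mulr idem_mul2 inc_mul_idem2 -idem_munit.
by apply: dincP; rewrite /= ?scaler0 ?addr0 ?add0r.
Qed.

End Normalization.

Section Equivalence.
Variables (d : Order.disp_t) (X : porderType d) (K : fieldType).
Variables (lambda : poset_involution X) (x0 : X) (c : K).
Implicit Types (a b : dinc X K) (S T : set X).
Hypotheses (hK : 2%N \notin [pchar K]) (Xconn : connected_poset X).
Hypotheses (x0fix : lambda x0 = x0) (x0uniq : forall x, lambda x = x -> x = x0).
Variables tau Phi : dinc X K -> dinc X K.
Hypotheses (tau_inv : dinc_involution tau) (Phi_inv : dinc_involution Phi).
Hypothesis tauE : tau =1 dinc_rho K lambda \o dtwist c.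
Variables v q : dinc X K.
Hypotheses (vq : v * q = 1) (PhiE : forall a, Phi a = v * tau a * q).

Let tauM a b : tau (a * b) = tau b * tau a. Proof. by case: tau_inv. Qed.
Let tauK : involutive tau. Proof. by case: tau_inv. Qed.
Let tauD a b : tau (a + b) = tau a + tau b.
Proof. by case: tau_inv => L _ _; have := L 1 a b; rewrite !scale1r. Qed.
Let qv : q * v = 1. Proof. exact: dinc_unitC. Qed.

Let tau_didems S : tau (didems K S) = didems K [set x | S (lambda x)]%classic.
Proof.
rewrite tauE; apply: dincP; last by apply: incP => x y; apply: mulr0.
apply: fincP => x y; rewrite [LHS]idemsE idemsE poset_inv_eq eq_sym.
by case: eqP => // ->.
Qed.

Let tau_dscal k m : tau (dscal X k m) = dscal X k (c * m).
Proof.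
rewrite tauE; apply: dincP; [apply: fincP|apply: incP] => x y.
  by rewrite [LHS]fincZE fincZE /= poset_inv_eq eq_sym.
by rewrite [LHS]incZE !incZE /= poset_inv_eq eq_sym mulrA.
Qed.

Let e0 := dalg (idem K x0).

Let e0E : e0 = didems K [set x0]%classic.
Proof.
congr dalg; apply: fincP => x y; rewrite idemE idemsE.
have -> : `[<[set x0]%classic x>] = (x == x0) by apply/asboolP/eqP.
by case: (x =P x0) => [->|_]; rewrite ?andbF ?andbT //= eq_sym.
Qed.

Let tau_e0 : tau e0 = e0.
Proof.
rewrite e0E tau_didems; congr didems; apply/seteqP; split=> x /=.
  by rewrite -{1}x0fix => /(can_inj (poset_invK lambda)).
by move->.
Qed.

Let zC a : v * tau q * a = a * (v * tau q).
Proof.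
apply: (involution_twist_central tauM tauK qv) => b.
by case: Phi_inv => _ _ /(_ b); rewrite !PhiE.
Qed.

(* A central element is determined by its product with e0, so that tau(y0) and
   v tau(q) y0 agree as soon as they do after multiplication by e0. *)
Let y0 := dscal X (q.1 x0 x0 : K) (q.2 x0 x0 : K).

Let y0C a : y0 * a = a * y0. Proof. exact: dscalC. Qed.

Let ty0C a : tau y0 * a = a * tau y0.
Proof. by rewrite /y0 tau_dscal; exact: dscalC. Qed.

Let y0_inv : exists y', y' * y0 = 1.
Proof.
have q_unit : v.1 x0 x0 * q.1 x0 x0 = 1.
  exact: finc_unit_diag (congr1 fst vq).
have qn0 : q.1 x0 x0 != 0.
  by apply: contra_eq_neq q_unit => ->; rewrite mulr0 eq_sym oner_neq0.
pose k : K := q.1 x0 x0; pose m : K := q.2 x0 x0.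
exists (dscal X k^-1 (- (k^-1 * m / k))); rewrite dscalM mulVf // mulNr.
by rewrite divfK // addrN dscal1.
Qed.

Let corner : e0 * q * e0 = y0 * e0. Proof. exact: didem_corner. Qed.

Let tau_y0 : tau y0 = v * tau q * y0.
Proof.
have := corner_twist tauM tauK qv zC ty0C tau_e0 corner.
have [k [m ->]] : exists k m, v * tau q = dscal X k m.
  by do 2!eexists; exact: dinc_central_scalar x0 Xconn zC.
by rewrite /y0 tau_dscal dscalM; apply: dscal_idem_inj.
Qed.

Let half : dinc X K := dscal X 2^-1 0.

Let half_sum : half + half = 1.
Proof.
have two0 : (2 : K) != 0 by move: hK; rewrite inE.
have e : 2^-1 + 2^-1 = 1 :> K by rewrite -[X in X + X]mulr1 -mulrDr mulVf.
by rewrite -dscal1 /half !dscalE !scale0r !addr0 -scalerDl e.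
Qed.

(** An involution that differs by an inner automorphism from tau, the standard
    involution up to the scaling of I(X, K) by c, is equivalent to tau. *)
Lemma involution_equivalent : dinc_equivalent Phi tau.
Proof.
have [S [Sdown Sdisj Scover]] := involution_splitting lambda.
have nSx0 : ~ S x0 by move=> Sx0; apply: (Sdisj x0 Sx0); rewrite x0fix.
pose S' := [set x | S (lambda x)]%classic; pose S0 := [set x0]%classic.
have d0 : didems K (@set0 X) = 0.
  apply: dincP => //; apply: fincP => x y; rewrite idemsE (_ : `[<_>] = false) ?andbF //.
  by apply/asboolPn.
have idI (A : set X) : didems K A * didems K A = didems K A by rewrite didemsM setIid.
have disj (A B : set X) : (forall x, A x -> ~ B x) -> didems K A * didems K B = 0.
  move=> AB; rewrite didemsM; apply: etrans d0.
  congr didems; apply/seteqP; split=> // x [].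
  exact: AB.
have esum : didems K S + e0 + didems K S' = 1.
  rewrite e0E; apply: dincP; last by rewrite /= !addr0.
  apply: fincP => x y; rewrite [LHS]fincDE fincDE !idemsE [RHS]/=.
  case: (x =P y) => [_|_] /=; last by rewrite !addr0.
  have [xx0|xx0] := pselect (x = x0).
    rewrite xx0 (asboolF nSx0) (@asboolT (S0 x0)) // (@asboolF (S' x0)) /S' /= ?x0fix //.
    by rewrite add0r addr0.
  rewrite (@asboolF (S0 x)) // addr0.
  have [Sx|nSx] := pselect (S x).
    by rewrite (asboolT Sx) (asboolF (Sdisj x Sx : ~ S' x)) addr0.
  rewrite (asboolF nSx) (@asboolT (S' x)) ?add0r //.
  by case: (Scover x) => // ; apply/eqP => /x0uniq.
have [y' y'y] := y0_inv.
have y'C := inv_central y'y y0C.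
have tauq' := scaled_symmetric tauM tauK qv zC y'y y0C tau_y0.
have q'w : y' * q * (v * y0) = 1 by rewrite mulrA -(mulrA y') qv mulr1.
have wq' : v * y0 * (y' * q) = 1 by rewrite mulrA -(mulrA v) y0C y'y mulr1.
have corner' : e0 * (y' * q) * e0 = e0.
  by rewrite mulrA -y'C -!mulrA (mulrA e0) corner mulrA y'y mul1r.
have nSS' x : S x -> ~ S' x by exact: Sdisj.
have e00 : e0 * e0 = e0 by rewrite e0E idI.
have e10 : didems K S * e0 = 0 by rewrite e0E; apply: disj => x Sx xx0; rewrite xx0 in Sx.
have e02 : e0 * didems K S' = 0.
  by rewrite e0E; apply: disj => _ -> /=; rewrite /S' /= x0fix.
have lo01 a : e0 * a * didems K S = 0.
  by rewrite e0E; apply: didems_mul0 => _ y -> Sy xy; apply: nSx0; apply: Sdown Sy.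
have lo20 a : didems K S' * a * e0 = 0.
  rewrite e0E; apply: didems_mul0 => x _ Sx -> xx0; apply: nSx0.
  by apply: Sdown Sx; rewrite -x0fix -poset_inv_le.
have lo21 a : didems K S' * a * didems K S = 0.
  by apply: didems_mul0 => x y S'x Sy xy; apply: (Sdisj x) S'x; apply: Sdown Sy.
have halfC a : half * a = a * half by exact: dscalC.
have tau_half : tau half = half by rewrite tau_dscal mulr0.
have [s ss] := symmetric_unit_factor tauD tauM tauK esum tau_e0 (tau_didems S)
  (idI S) e10 (disj S S' nSS') e00 e02 (idI S') lo01 lo20 lo21 halfC half_sum
  tau_half q'w wq' tauq' corner'.
pose t := v * y0 * tau s.
have ts : t * s = 1 by rewrite /t -mulrA ss wq'.
have st : s * t = 1 by exact: dinc_unitC.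
exists (fun a => s * a * t); split.
- by move=> k a b; rewrite mulrDr mulrDl -dinc_scaleAr -dinc_scaleAl.
- by split=> [|a b]; [rewrite mulr1 st | rewrite conjM].
- by exists (fun a => t * a * s) => a; rewrite conjK.
move=> a /=; rewrite PhiE.
exact: (conj_transfer tauM tauK qv y'y y0C ss st).
Qed.

End Equivalence.

Theorem theorem6p24 (K : fieldType) (d : Order.disp_t) (X : porderType d)
    (hK : 2%N \notin [pchar K])
    (hX : connected_poset X)
    (hmult : forall sigma : incidence X K,
      multiplicative_inc sigma -> inner_aut (mult_aut sigma))
    (hder : forall D : finc X K -> incidence X K,
      is_derivation D -> inner_derivation D)
    (lambda : poset_involution X)
    (hlambda : exists! x : X, lambda x = x)
    (Phi : dinc X K -> dinc X K)
    (hPhi : dinc_involution Phi)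
    (hind : induces Phi lambda) :
  dinc_equivalent Phi (dinc_rho K lambda) \/
  dinc_equivalent Phi (dinc_rho K lambda \o @dinc_neg d X K).
Proof.
have [x0 [x0fix x0uniq]] := hlambda.
have [PhiL PhiM PhiK] := hPhi.
have rho_inv := dinc_rho_involution K lambda; have [rhoL rhoM' rhoK'] := rho_inv.
have Phi_inj : injective Phi by exact: can_inj PhiK.
have rho_inj : injective (dinc_rho K lambda) by exact: can_inj rhoK'.
have [w [w' [c [ww' OmE]]]] : exists (w w' : dinc X K) (c : K),
    w * w' = 1 /\
    forall a, Phi (dinc_rho K lambda a) = w * dtwist c a * w'.
  apply: (@dinc_aut_inner _ _ _ lambda x0 hX hmult hder (Phi \o dinc_rho K lambda)).
  - by move=> k a b /=; rewrite rhoL PhiL.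
  - by move=> a b /=; rewrite rhoM' PhiM.
  - by move=> a b /= /Phi_inj /rho_inj.
  - by move=> b; exists (dinc_rho K lambda (Phi b)); rewrite /= rhoK' PhiK.
  move=> x z.
  have -> : (Phi \o dinc_rho K lambda) (dalg (idem K x)) = Phi (idem K (lambda x), 0).
    rewrite /=; congr Phi; apply: dincP; first by rewrite -rho_idem.
    exact: incP.
  have [u [v [uv vu]]] := hind (lambda x).
  rewrite poset_invK => /(congr1 (fun a : dinc X K => a.1 z z)).
  rewrite [LHS]idemE andbb [RHS]finc_mul_diag finc_mul_diag mulrAC => ->.
  by rewrite (finc_unit_diag z (congr1 fst uv)) mul1r.
have PhiE a : Phi a = w * dtwist c (dinc_rho K lambda a) * w' by rewrite -OmE rhoK'.
(* The central element t = (0, 1) is fixed by rho, hence Phi(t) = c t. *)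
have cc : c * c = 1.
  pose t := dmod (delta X K).
  have Pt (k : K) : Phi (k *: t) = (c * k) *: t.
    have tC a : t * a = a * t by rewrite /t dmodMl dmodMr inc_mul1l inc_mul1r.
    have rt : dinc_rho K lambda t = t.
      apply: dincP; [apply: fincP|apply: incP] => x y //=.
      by rewrite poset_inv_eq eq_sym.
    have rZ : dinc_rho K lambda (k *: t) = k *: t.
      by rewrite -{2}rt; apply: dincP; [apply: fincP|apply: incP].
    have tw : dtwist c (k *: t) = (c * k) *: t.
      apply: dincP; [rewrite [RHS]scaler0; exact: scaler0 | exact: scalerA].
    rewrite PhiE rZ tw.
    by rewrite -dinc_scaleAr -dinc_scaleAl -tC -mulrA ww' mulr1.
  have := PhiK (1 *: t); rewrite !Pt mulr1 => /(congr1 (fun a : dinc X K => a.2 x0 x0)).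
  by rewrite [LHS]incZE [RHS]incZE /= eqxx !mulr1.
have twist_swap a : dtwist c (dinc_rho K lambda a) = dinc_rho K lambda (dtwist c a).
  by apply: dincP => //; apply: incP.
have PhiE' a : Phi a = w * dinc_rho K lambda (dtwist c a) * w'.
  by rewrite -twist_swap.
have : (c == 1) || (c == -1) by rewrite -sqrf_eq1 expr2 cc.
case/orP => /eqP ec; [left|right].
  have twistE a : dtwist c a = a by apply: dincP; rewrite //= ec scale1r.
  apply: (@involution_equivalent _ _ _ lambda x0 c hK hX x0fix) ww' _ => //.
  - by move=> x /x0uniq.
  - by move=> a /=; rewrite twistE.
  - by move=> a; rewrite PhiE' twistE.
have twistE a : dtwist c a = dinc_neg a by apply: dincP; rewrite //= ec scaleN1r.
apply: (@involution_equivalent _ _ _ lambda x0 c hK hX x0fix) ww' _ => //.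
- by move=> x /x0uniq.
- exact: dinc_rho_neg_involution.
- by move=> a /=; rewrite twistE.
- by move=> a; rewrite PhiE' twistE.
Qed.
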